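(* Let $A,C$ ($\mathbb R^{n\times n}$-valued), $B,D$ ($\mathbb R^{n\times m}$-valued), $Q$ ($\mathbb S^n$-valued), $R$ ($\mathbb S^m$-valued) and $S$ ($\mathbb R^{m\times n}$-valued) be bounded $\mathbb F$-progressively measurable processes on $[0,T]$, and let $G$ be a bounded $\mathcal F_T$-measurable $\mathbb S^n$-valued random variable. Suppose that for some $\delta>0$ one of the following two conditions holds (a.e. on $[0,T]$, a.s.): (1) $G\ge0$, $Q(\cdot)\ge0$, $S(\cdot)=0$, $R(\cdot)\ge\delta I_m$; or (2) $D(\cdot)^\top D(\cdot)\ge\delta I_m$, $G\ge\delta I_n$, $Q(\cdot)\ge0$, $R(\cdot)\ge0$, $S(\cdot)=0$. Then for every $t\in[0,T)$ the mapping $u\mapsto J(t,0;u)$ is uniformly convex, i.e. there is a constant $\delta'>0$ such that $$J(t,0;u)\ge\delta'\,\mathbb E\int_t^T|u(s)|^2ds,\qquad\forall u\in\mathcal U[t,T].$$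
   Context: Fix $T>0$ and positive integers $n,m$. $(\Omega,\mathcal F,\mathbb F,\mathbb P)$ is a complete filtered probability space carrying a standard one-dimensional Brownian motion $W$, and $\mathbb F=\{\mathcal F_t\}_{t\ge0}$ is the natural filtration of $W$ augmented by all $\mathbb P$-null sets. $\mathbb S^n$ is the space of symmetric real $n\times n$ matrices, ordered by positive semidefiniteness; $\langle\cdot,\cdot\rangle$ is the Euclidean inner product. $\mathcal U[t,T]=L^2_{\mathbb F}(t,T;\mathbb R^m)$ is the space of $\mathbb F$-progressively measurable $u:[t,T]\times\Omega\to\mathbb R^m$ with $\mathbb E\int_t^T|u|^2ds<\infty$. For $u\in\mathcal U[t,T]$, let $X$ be the unique continuous square-integrable solution of $dX=(AX+Bu)ds+(CX+Du)dW(s)$ on $[t,T]$, $X(t)=0$, and $$J(t,0;u)=\mathbb E\Big[\langle GX(T),X(T)\rangle+\int_t^T\big(\langle QX,X\rangle+2\langle SX,u\rangle+\langle Ru,u\rangle\big)ds\Big].$$ *)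

(* Defs.v *)
From HB Require Import structures.
From mathcomp Require Import all_boot all_order all_algebra.
From mathcomp Require Import all_classical all_reals all_analysis.
Set Implicit Arguments.
Unset Strict Implicit.
Unset Printing Implicit Defensive.
Import Order.TTheory GRing.Theory Num.Theory.
Import numFieldNormedType.Exports.
Local Open Scope classical_set_scope.
Local Open Scope ring_scope.

Section linear_algebra.
Context {R : realType}.

Definition inner n (x y : 'cV[R]_n) : R := \sum_(i < n) x i 0 * y i 0.

(** Loewner order [M <= N]; used on symmetric matrices only. *)
Definition loewner_le n (M N : 'M[R]_n) : Prop :=
  forall x : 'cV[R]_n, 0 <= inner ((N - M) *m x) x.

End linear_algebra.

Section stochastic_calculus.
Context {d : measure_display} {Omega : measurableType d} {R : realType}.
Variable P : probability Omega R.

Notation leb := (@lebesgue_measure R).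

Definition augmented_filtration (W : R -> {RV P >-> R}) (t : R)
    : set (set Omega) :=
  <<s [set A | exists (s : R) (B : set R),
         [/\ 0 <= s, s <= t, measurable B & A = W s @^-1` B]]
      `|` [set N | P.-negligible N] >>.

(** [normal_prob m sigma] has standard deviation [sigma], whence the square
    root.  The process is indexed by the whole of [R], but only nonnegative
    times matter. *)
Definition standard_brownian_motion (W : R -> {RV P >-> R}) : Prop :=
  [/\ {ae P, forall w, W 0 w = 0},
      {ae P, forall w, {within `[0, +oo[, continuous (fun s => W s w)}},
      (forall (s t : R) (B : set R), 0 <= s -> s < t -> measurable B ->
         P ((fun w => (W t w - W s w)%R) @^-1` B) = normal_prob 0 (Num.sqrt (t - s)) B)
    & (forall (s t : R) (A : set Omega) (B : set R), 0 <= s -> s < t ->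
         augmented_filtration W s A -> measurable B ->
         P (A `&` ((fun w => (W t w - W s w)%R) @^-1` B)) =
           (P A * P ((fun w => (W t w - W s w)%R) @^-1` B))%E)].

Section with_filtration.
Variable F : R -> set (set Omega).

Definition adapted_rv (t : R) (xi : Omega -> R) : Prop :=
  measurable_fun (setT : set (g_sigma_algebraType (F t))) xi.

Definition adapted_rv_mx p q (t : R) (xi : Omega -> 'M[R]_(p, q)) : Prop :=
  forall i j, adapted_rv t (fun w => xi w i j).

Definition progressive (t T : R) (phi : R -> Omega -> R) : Prop :=
  forall s : R, t <= s -> s <= T ->
    measurable_fun (`[t, s] `*` setT : set (R * g_sigma_algebraType (F s)))
      (fun p => phi p.1 p.2).

Definition progressive_mx p q (t T : R) (phi : R -> Omega -> 'M[R]_(p, q))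
    : Prop :=
  forall i j, progressive t T (fun s w => phi s w i j).

Definition ae_dtdP (T : R) (p : R -> Omega -> Prop) : Prop :=
  {ae (leb \x P)%E, forall z, 0 <= z.1 <= T -> p z.1 z.2}.

(** Essentially bounded, which covers bounded everywhere. *)
Definition bounded_progressive p q (T : R) (phi : R -> Omega -> 'M[R]_(p, q))
    : Prop :=
  progressive_mx 0 T phi /\
  exists K : R, ae_dtdP T (fun s w => forall i j, `|phi s w i j| <= K).

Definition energy p (t T : R) (u : R -> Omega -> 'cV[R]_p) : \bar R :=
  (\int[P]_w \int[leb]_(s in `[t, T]) (inner (u s w) (u s w))%:E)%E.

Definition L2_progressive p (t T : R) (u : R -> Omega -> 'cV[R]_p) : Prop :=
  progressive_mx t T u /\ (energy t T u < +oo)%E.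

(** The simple process equal to [sp_coef i] on
    [`]sp_time i, sp_time i.+1]] for [i < sp_size]. *)
Record simple_process := SimpleProcess {
  sp_size : nat ;
  sp_time : nat -> R ;
  sp_coef : nat -> Omega -> R }.

Definition is_simple (t T : R) (h : simple_process) : Prop :=
  [/\ sp_time h 0%N = t,
      sp_time h (sp_size h) = T,
      (forall i, (i < sp_size h)%N -> sp_time h i < sp_time h i.+1),
      (forall i, (i < sp_size h)%N ->
         adapted_rv (sp_time h i) (sp_coef h i))
    & exists K : R, forall i w, (i < sp_size h)%N -> `|sp_coef h i w| <= K].

Definition simple_value (h : simple_process) (s : R) (w : Omega) : R :=
  \sum_(i < sp_size h)
     sp_coef h i w * \1_(`]sp_time h i, sp_time h i.+1]) s.

Definition simple_integral (W : R -> {RV P >-> R}) (h : simple_process)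
    (s : R) (w : Omega) : R :=
  \sum_(i < sp_size h)
     sp_coef h i w *
       (W (Num.min (sp_time h i.+1) s) w - W (Num.min (sp_time h i) s) w).

(** [I s] is a version of the Ito integral of [H] over [[t, s]]: the
    mean-square limit of the integrals of simple processes approximating [H]
    in [L^2(dt (x) dP)].  By the Ito isometry the limit does not depend on the
    approximating sequence, so it is enough that one exists. *)
Definition is_ito_integral (W : R -> {RV P >-> R}) (t T : R)
    (H I : R -> Omega -> R) : Prop :=
  exists h : nat -> simple_process,
    [/\ (forall k, is_simple t T (h k)),
        (fun k => \int[P]_w \int[leb]_(r in `[t, T])
            ((simple_value (h k) r w - H r w) ^+ 2)%:E)%E @ \oo --> 0%E
      & forall s : R, t <= s <= T ->
          measurable_fun setT (I s) /\
          (fun k => \int[P]_w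
            ((simple_integral W (h k) s w - I s w) ^+ 2)%:E)%E
              @ \oo --> 0%E].

Section control_problem.
Variables (n m : nat).

(** [X] is a continuous square-integrable solution on [[t, T]] of
    [dX = (A X + B u) ds + (C X + D u) dW], [X(t) = x0]. *)
Definition is_state (W : R -> {RV P >-> R})
    (A C : R -> Omega -> 'M[R]_n) (B D : R -> Omega -> 'M[R]_(n, m))
    (t T : R) (x0 : 'cV[R]_n) (u : R -> Omega -> 'cV[R]_m)
    (X : R -> Omega -> 'cV[R]_n) : Prop :=
  [/\ L2_progressive t T X,
      {ae P, forall w, {within `[t, T], continuous (fun s => X s w)}}
    & exists I : 'I_n -> R -> Omega -> R,
        (forall i, is_ito_integral W t T
           (fun s w => (C s w *m X s w + D s w *m u s w) i 0) (I i)) /\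
        forall s : R, t <= s <= T -> {ae P, forall w, forall i,
          X s w i 0 = x0 i 0
            + \int[leb]_(r in `[t, s]) ((A r w *m X r w + B r w *m u r w) i 0)
            + I i s w}].

(** The weight written [N] is the control weight, traditionally [R], a letter
    taken here by the real field. *)
Definition cost (G : Omega -> 'M[R]_n) (Q : R -> Omega -> 'M[R]_n)
    (S : R -> Omega -> 'M[R]_(m, n)) (N : R -> Omega -> 'M[R]_m)
    (t T : R) (X : R -> Omega -> 'cV[R]_n) (u : R -> Omega -> 'cV[R]_m)
    : \bar R :=
  'E_P[fun w => inner (G w *m X T w) (X T w)
    + \int[leb]_(s in `[t, T])
        (inner (Q s w *m X s w) (X s w)
         + 2 * inner (S s w *m X s w) (u s w)
         + inner (N s w *m u s w) (u s w))].

End control_problem.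
End with_filtration.
End stochastic_calculus.

(* Main.v *)
From HB Require Import structures.
Require Import Defs.
From mathcomp Require Import all_boot all_order all_algebra.
From mathcomp Require Import all_classical all_reals all_analysis.
From mathcomp Require Import measurable_realfun normal_distribution.
From mathcomp Require Import ring lra.
Set Implicit Arguments.
Unset Strict Implicit.
Unset Printing Implicit Defensive.
Import Order.TTheory GRing.Theory Num.Theory.
Import numFieldNormedType.Exports.
Local Open Scope classical_set_scope.
Local Open Scope ring_scope.

(** Write beta = A X + B u and Z = C X + D u, so that dX = beta ds + Z dW.

    Under the first set of conditions the claim is immediate: the terminal and
    the state costs are nonnegative and the control cost is at least
    delta |u|^2 (lemma [cost_lower_bound]).

    Under the second set the cost is at least delta E|X(T)|^2, and everything
    rests on the bound E int |u|^2 <= K E|X(T)|^2, with K independent of u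
    ([terminal_dominates_control]).  Since D^T D >= delta, the control is
    dominated by X and Z; hence so is beta, and X behaves as the solution of a
    linear backward equation with martingale part Z, which its terminal value
    controls.  The classical proof of the backward estimate applies the Ito
    formula to |X|^2 and then the Gronwall lemma.  Here both are replaced by an
    orthogonality argument on short intervals: for a <= b,

      X(a) + (I(b) - I(a)) = X(b) - int_a^b beta,

    where I is the stochastic integral of Z.  The two summands on the left are
    orthogonal in L^2, because X(a) is known at time a, so

      E|X(a)|^2 + E int_a^b |Z|^2 <= const (E|X(b)|^2 + (b - a) E int_a^b |beta|^2)

    ([backward_step]).  As |beta|^2 is dominated by |X|^2 + |Z|^2, the last term
    is absorbed on the left when b - a is small ([small_step]), and finitely
    many such steps lead from T back to t ([iterated_steps]).

    The orthogonality is a Pythagorean inequality for the Ito integral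
    ([ito_pythagoras_le]).  For integrals of simple processes it is an exact
    identity ([simple_pythagoras]), obtained by adding one Brownian increment
    at a time: given the past, an increment is a centred Gaussian of variance
    b - a, so that the conditional expectation of (xi + c (W b - W a))^2 is
    xi^2 + c^2 (b - a) ([increment_pythagoras]).  Only integrals of nonnegative
    functions occur there, and Tonelli's theorem is enough.  The passage to
    mean-square limits keeps the inequality up to a constant factor, by
    (x + y)^2 <= 2 x^2 + 2 y^2. *)

(** * Densities and moments of the normal law *)

Section density.
Context d (T : measurableType d) (R : realType).
Variables (mu nu : {measure set T -> \bar R}) (g : T -> R).
Hypotheses (mg : measurable_fun setT g) (g0 : forall x, 0 <= g x).
Hypothesis nuE : forall A, measurable A -> nu A = (\int[mu]_(x in A) (g x)%:E)%E.

Import HBNNSimple.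

Let integral_density_nnsfun (f : {nnsfun T >-> R}) :
  (\int[nu]_x (f x)%:E = \int[mu]_x ((f x)%:E * (g x)%:E))%E.
Proof.
have f1 r x : 0 <= r * \1_(f @^-1` [set r]) x.
  by have := nnfun_muleindic_ge0 f r x; rewrite -EFinM lee_fin.
under [LHS]eq_integral do rewrite fimfunE -fsumEFin//.
rewrite [LHS]ge0_integral_fsum//; last 2 first.
  - by move=> r; exact/measurable_EFinP/measurableT_comp.
  - by move=> n x _; rewrite lee_fin f1.
under [RHS]eq_integral.
  move=> x xD; rewrite fimfunE -fsumEFin// ge0_mule_fsuml; last first.
    by move=> r; rewrite lee_fin f1.
  over.
rewrite [RHS]ge0_integral_fsum//; last 2 first.
  - move=> r; apply: emeasurable_funM; apply/measurable_EFinP => //.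
    exact/measurableT_comp.
  - by move=> n x _; rewrite mule_ge0 ?lee_fin.
apply: eq_fsbigr => r; rewrite inE => -[x _ fxr].
have r0 : 0 <= r by rewrite -fxr.
have mA : measurable (f @^-1` [set r]) by exact: measurable_funPTI.
under eq_integral do rewrite EFinM.
rewrite ge0_integralZl//; last exact/measurable_EFinP/measurable_indic.
rewrite integral_indic// setIT nuE// integral_mkcond.
under [in RHS]eq_integral do rewrite EFinM -muleA.
rewrite [RHS]ge0_integralZl//; last 2 first.
  - by apply: emeasurable_funM; exact/measurable_EFinP.
  - by move=> y _; rewrite mule_ge0 ?lee_fin.
congr (_ * _)%E; apply: eq_integral => y _; rewrite patchE indicE.
by case: ifPn => yA; rewrite ?mul1e// mul0e.
Qed.

Lemma ge0_integral_density (f : T -> \bar R) : measurable_fun setT f ->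
  (forall x, 0 <= f x)%E -> (\int[nu]_x f x = \int[mu]_x (f x * (g x)%:E))%E.
Proof.
move=> mf f0; pose f_ := nnsfun_approx measurableT mf.
transitivity (limn (fun n => \int[nu]_x (f_ n x)%:E)%E).
  rewrite -monotone_convergence//=.
  - apply: eq_integral => x _; apply/esym/cvg_lim => //=.
    exact: cvg_nnsfun_approx.
  - by move=> n; exact/measurable_EFinP/measurable_funTS.
  - by move=> n ? _; rewrite lee_fin.
  - by move=> ? _ ? ? mn; rewrite lee_fin; exact/lefP/nd_nnsfun_approx.
transitivity (limn (fun n => \int[mu]_x ((f_ n x)%:E * (g x)%:E))%E).
  by apply: congr_lim; apply/funext => n; exact: integral_density_nnsfun.
rewrite -monotone_convergence//=.
- apply: eq_integral => x _; apply/cvg_lim => //=.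
  apply: cvgeZr; first by [].
  exact: cvg_nnsfun_approx.
- by move=> n; apply: emeasurable_funM; apply/measurable_EFinP => //.
- by move=> n ? _; rewrite lee_fin mulr_ge0.
- move=> ? _ ? ? mn; rewrite lee_wpmul2r ?lee_fin//.
  exact/lefP/nd_nnsfun_approx.
Qed.

End density.

Section normal_moments.
Context {R : realType}.
Notation mu := (@lebesgue_measure R).
Variable s : R.
Hypothesis s_gt0 : 0 < s.

Let p := normal_pdf 0 s.

Let pE x : p x = normal_peak s * expR (- x ^+ 2 / (s ^+ 2 *+ 2)).
Proof. by rewrite /p normal_pdfE ?gt_eqF// /normal_fun subr0. Qed.

Let cp : continuous p.
Proof. by apply: continuous_normal_pdf; rewrite gt_eqF. Qed.

Let p_ge0 x : 0 <= p x. Proof. exact: normal_pdf_ge0. Qed.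

Let p_even x : p (- x) = p x.
Proof. by rewrite !pE sqrrN. Qed.

Let is_derive_p (x : R) : is_derive x 1 (fun y => - s ^+ 2 * p y) (x * p x).
Proof.
have -> : (fun y => - s ^+ 2 * p y) = (fun y => - s ^+ 2 * (normal_peak s *
    expR (- y ^+ 2 / (s ^+ 2 *+ 2)))) by apply/funext => y; rewrite pE.
apply: is_derive_eq.
rewrite pE /GRing.scale/=.
have s0 : s != 0 by rewrite gt_eqF.
by field.
Qed.

(** Follows from exp y >= 1 + y; it makes the boundary term of the integration
    by parts vanish at infinity. *)
Let p_tail (x : R) : 0 < x -> x * p x <= normal_peak s * (s ^+ 2 *+ 2) / x.
Proof.
move=> x0; rewrite pE mulrCA -mulrA ler_wpM2l ?normal_peak_ge0//.
have v0 : 0 < s ^+ 2 *+ 2 by rewrite pmulrn_lgt0// exprn_gt0.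
rewrite ler_pdivlMr// mulrAC -expr2 mulNr expRN.
rewrite -[leLHS]/(_ / _) ler_pdivrMr ?expR_gt0//.
rewrite -ler_pdivrMl// mulrC; apply: le_trans (expR_ge1Dx _).
by rewrite lerDr.
Qed.

Let integral_x2p (b : R) : 0 < b ->
  (\int[mu]_(x in `[0%R, b]) (x ^+ 2 * p x)%:E =
   (- (s ^+ 2 * (b * p b)))%:E +
     (s ^+ 2)%:E * \int[mu]_(x in `[0%R, b]) (p x)%:E)%E.
Proof.
move=> b0.
have dG x : derivable (fun y => - s ^+ 2 * p y) x 1.
  by have [] := is_derive_p x.
have cG : continuous (fun y => - s ^+ 2 * p y).
  by move=> x; apply: cvgM; [exact: cvg_cst|exact: cp].
have cid : {within `[0, b], continuous (fun x => x * p x)}.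
  apply: continuous_subspaceT => x.
  by apply: cvgM; [exact: cvg_id|exact: cp].
have := @integration_by_parts R id (fun y => - s ^+ 2 * p y) (cst 1)
  (fun x => x * p x) 0 b b0.
rewrite /= mul0r subr0 => /(_ _ _ _ cid)E.
under eq_integral do rewrite expr2 -mulrA.
rewrite {}E.
- have ip : mu.-integrable `[0, b] (EFin \o p).
    by apply: integrableS (integrable_normal_pdf 0 s).
  under eq_integral do rewrite mul1r EFinM.
  rewrite integralZl// EFinN mulNe oppeK.
  by congr (_%:E + _)%E; ring.
- exact/continuous_subspaceT/cst_continuous.
- split => [x _||].
  + exact: derivable_id.
  + exact: cvg_at_right_filter.
  + exact: cvg_at_left_filter.
- by move=> x _; rewrite derive1E derive_id.
- split => [x _||].
  + exact: dG.
  + exact/cvg_at_right_filter/cG.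
  + exact/cvg_at_left_filter/cG.
- by move=> x _; rewrite derive1E; exact: derive_val.
Qed.

(** Integration by parts on [0, b] turns x (x p(x)) into p(x), up to a boundary
    term that vanishes as b grows; the evenness of p does the rest. *)
Lemma normal_second_moment :
  (\int[normal_prob 0 s]_x (x ^+ 2)%:E = (s ^+ 2)%:E)%E.
Proof.
have mp : measurable_fun setT p by exact: measurable_normal_pdf.
have mx2p : measurable_fun setT (fun x : R => x ^+ 2 * p x).
  exact: measurable_funM.
have half_moment : (\int[mu]_(x in `[0%R, +oo[) (x ^+ 2 * p x)%:E =
    (s ^+ 2)%:E * \int[mu]_(x in `[0%R, +oo[) (p x)%:E)%E.
  have x2p_ge0 (x : R) : 0 <= x ^+ 2 * p x by rewrite mulr_ge0 ?sqr_ge0.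
  have := @ge0_cvgn_integral R mu _ x2p_ge0 mx2p.
  move/cvg_lim => <-//; apply/cvg_lim => //.
  have -> : ((s ^+ 2)%:E * \int[mu]_(x in `[0%R, +oo[) (p x)%:E =
    0 + (s ^+ 2)%:E * \int[mu]_(x in `[0%R, +oo[) (p x)%:E)%E by rewrite add0e.
  have cvg_bdry : (- (s ^+ 2 * (n%:R * p n%:R)))%:E @[n --> \oo] --> 0%E.
    rewrite -[0%E]/(0%:E); apply/cvg_EFin; first exact: nearW.
    rewrite -[X in _ --> X]oppr0 -[X in - X](mulr0 (s ^+ 2)).
    apply: cvgN; apply: cvgMl_tmp.
    have inv0 : (n%:R : R)^-1 @[n --> \oo] --> (0 : R).
      apply/gtr0_cvgV0; last exact: cvgr_idn.
      by near=> n; rewrite ltr0n; near: n; exists 1%N.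
    apply: (@squeeze_cvgr _ _ _ _ (cst 0)
      (fun n : nat => normal_peak s * (s ^+ 2 *+ 2) / n%:R)).
    - near=> n; rewrite mulr_ge0//=; apply: p_tail.
      by rewrite ltr0n; near: n; exists 1%N.
    - exact: cvg_cst.
    - rewrite -[X in _ --> X](mulr0 (normal_peak s * (s ^+ 2 *+ 2))).
      exact: cvgMl_tmp.
  have cvg_half := @ge0_cvgn_integral R mu _ p_ge0 mp.
  apply: cvg_trans (cvgeD _ cvg_bdry (cvgeZl _ cvg_half)) => //.
  apply: near_eq_cvg; near=> n; rewrite integral_x2p// ltr0n.
  by near: n; exists 1%N.
rewrite (@ge0_integral_density _ _ _ mu (normal_prob 0 s) p)//.
- under eq_integral do rewrite -EFinM.
  have := integral_normal_pdf (0:R) s.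
  rewrite -/p ge0_symfun_integralT// => [pT|x]; last by rewrite /= p_even.
  rewrite ge0_symfun_integralT//.
  + by rewrite -set_itvcy half_moment muleCA set_itvcy pT mule1.
  + by move=> x; rewrite mulr_ge0 ?sqr_ge0.
  + move=> x; apply: cvgM; last exact: cp.
    exact: exprn_continuous.
  + by move=> x /=; rewrite sqrrN p_even.
- exact/measurable_EFinP.
- by move=> x; rewrite lee_fin sqr_ge0.
Unshelve. all: by end_near. Qed.

Lemma normal_prob_symmetric (f : R -> \bar R) : measurable_fun setT f ->
  (forall x, 0 <= f x)%E ->
  (\int[normal_prob 0 s]_x f (- x)%R = \int[normal_prob 0 s]_x f x)%E.
Proof.
move=> mf f0.
have mp : measurable_fun setT p by exact: measurable_normal_pdf.
have mfN : measurable_fun setT (fun x : R => f (- x)) by exact: measurableT_comp.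
rewrite !(@ge0_integral_density _ _ _ mu (normal_prob 0 s) p)//.
pose h x := (f x * (p x)%:E)%E.
transitivity (\int[mu]_x h (- x)%R)%E.
  by apply: eq_integral => x _; rewrite /h p_even.
have mh : measurable_fun setT h.
  by apply: emeasurable_funM => //; exact/measurable_EFinP.
have h0 x : (0 <= h x)%E by rewrite mule_ge0// lee_fin.
have mN : measurable_fun setT (-%R : R -> measurableTypeR R) by [].
rewrite -[RHS](@eq_measure_integral _ _ _ _ _ (pushforward mu (-%R : R -> measurableTypeR R))).
  by rewrite ge0_integral_pushforward// => x _; exact: h0.
by move=> A mA _; exact: lebesgue_measureN.
Qed.

(** Averaging the integrand with its mirror image cancels the cross term
    2 a c x, so that only integrals of nonnegative functions appear. *)
Lemma integral_normal_affine_sqr (a c : R) :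
  (\int[normal_prob 0 s]_x (((a + c * x) ^+ 2)%R)%:E =
   (a ^+ 2 + c ^+ 2 * s ^+ 2)%:E)%E.
Proof.
have maff (e : R) : measurable_fun setT (fun x : R => ((a + e * x) ^+ 2)%:E).
  by apply/measurable_EFinP/measurable_funX/measurable_funD => //; exact: measurable_funM.
have sym := @normal_prob_symmetric _ (maff c).
set I := LHS.
have II : (I + I = (2 * (a ^+ 2 + c ^+ 2 * s ^+ 2))%:E)%E.
  rewrite {1}/I -sym; last by move=> x; rewrite lee_fin sqr_ge0.
  rewrite /I -ge0_integralD//; last 4 first.
  - by move=> x _; rewrite lee_fin sqr_ge0.
  - under eq_fun do rewrite mulrN -mulNr; exact: maff.
  - by move=> x _; rewrite lee_fin sqr_ge0.
  - exact: maff.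
  transitivity (\int[normal_prob 0 s]_x ((2 * a ^+ 2)%:E +
      (2 * c ^+ 2)%:E * (x ^+ 2)%:E))%E.
    by apply: eq_integral => x _; rewrite -EFinM -!EFinD; congr EFin; ring.
  rewrite ge0_integralD//; last 3 first.
  - by move=> x _; rewrite lee_fin mulr_ge0 ?sqr_ge0.
  - by move=> x _; rewrite mule_ge0// lee_fin ?sqr_ge0// mulr_ge0 ?sqr_ge0.
  - by apply: emeasurable_funM => //; apply/measurable_EFinP; exact: measurable_funX.
  rewrite integral_cst// ge0_integralZl//; last 3 first.
  - by apply/measurable_EFinP; exact: measurable_funX.
  - by move=> x _; rewrite lee_fin sqr_ge0.
  - by rewrite lee_fin mulr_ge0 ?sqr_ge0.
  rewrite normal_second_moment [X in (_ * X + _)%E](_ : _ = 1%E); last first.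
    exact: integral_normal_pdf.
  by rewrite mule1 -EFinM -EFinD; congr EFin; ring.
have I_fin : I \is a fin_num.
  rewrite ge0_fin_numE; last first.
    by apply: integral_ge0 => x _; rewrite lee_fin sqr_ge0.
  apply: (@le_lt_trans _ _ (I + I)%E); last by rewrite II ltry.
  by rewrite leeDl// integral_ge0// => x _; rewrite lee_fin sqr_ge0.
move: II; rewrite -(fineK I_fin) -EFinD => -[] h; congr EFin; lra.
Qed.

End normal_moments.

(** * Brownian increments and the augmented filtration *)

Section filtration.
Context {d : measure_display} {Omega : measurableType d} {R : realType}.
Variable P : probability Omega R.
Hypothesis Pcomplete : measure_is_complete P.
Variable W : R -> {RV P >-> R}.
Notation F := (augmented_filtration W).
Notation Ft t := (g_sigma_algebraType (F t)).

Lemma augmented_filtration_sub t : F t `<=` measurable.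
Proof.
apply: smallest_sub; first exact: sigma_algebra_measurable.
move=> A [[s [B [_ _ mB ->]]]|NA]; first exact: measurable_funPTI.
exact: Pcomplete.
Qed.

Lemma measurable_filtrationE t :
  (measurable : set (set (Ft t))) = F t.
Proof. exact/sigma_algebra_id/smallest_sigma_algebra. Qed.

Lemma augmented_filtration_mono s t : s <= t -> F s `<=` F t.
Proof.
move=> st; apply: sub_sigma_algebra2 => A [[r [B [r0 rs mB ->]]]|NA]; [left|by right].
by exists r, B; split => //; exact: le_trans st.
Qed.

Lemma adapted_mono s t (xi : Omega -> R) : s <= t ->
  adapted_rv F s xi -> adapted_rv F t xi.
Proof.
move=> st axi _ B mB; rewrite measurable_filtrationE.
apply: (augmented_filtration_mono st); rewrite -measurable_filtrationE.
exact: axi.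
Qed.

Lemma adapted_brownian s t : 0 <= s -> s <= t -> adapted_rv F t (W s).
Proof.
move=> s0 st _ B mB; rewrite setTI measurable_filtrationE.
by apply: sub_sigma_algebra; left; exists s, B.
Qed.

Lemma measurable_id_filtration t : measurable_fun setT (id : Omega -> Ft t).
Proof.
move=> _ B; rewrite setTI measurable_filtrationE; exact: augmented_filtration_sub.
Qed.

Lemma adapted_measurable t (xi : Omega -> R) :
  adapted_rv F t xi -> measurable_fun setT xi.
Proof. by move=> axi; exact: measurableT_comp axi (@measurable_id_filtration t). Qed.

Hypothesis WBM : standard_brownian_motion W.

(** Freezing: the increment after time [a] is independent of the past, so the
    pair (past, increment) has a product law, and Tonelli's theorem applies.
    The past is the whole sample space carrying the sigma-algebra of time [a],
    which allows [phi] to depend on any number of past random variables. *)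
Lemma increment_distribution a b : 0 <= a -> a < b ->
  forall (phi : Ft a * measurableTypeR R -> \bar R),
  measurable_fun setT phi -> (forall z, 0 <= phi z)%E ->
  (\int[P]_w phi (w, (W b w - W a w)%R) =
   \int[P]_w \int[normal_prob 0 (Num.sqrt (b - a))]_y phi (w, y))%E.
Proof.
move=> a0 ab phi mphi phi0.
have [_ _ WN Wind] := WBM.
pose nu := normal_prob (0 : R) (Num.sqrt (b - a)).
pose D w := W b w - W a w.
have mD : measurable_fun setT D by exact: measurable_funB.
have mid := @measurable_id_filtration a.
pose idm := isMeasurableFun.Build _ _ Omega (Ft a) _ mid.
pose idF : {mfun Omega >-> Ft a} := HB.pack (id : Omega -> Ft a) idm.
have mJ : measurable_fun setT ((fun w => (w, D w)) : Omega -> Ft a * measurableTypeR R).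
  exact: measurable_fun_pair.
pose Jm := isMeasurableFun.Build _ _ Omega (Ft a * measurableTypeR R)%type _ mJ.
pose J : {mfun Omega >-> (Ft a * measurableTypeR R)%type} := HB.pack ((fun w => (w, D w)) : Omega -> Ft a * measurableTypeR R) Jm.
have joint : forall X : set (Ft a * measurableTypeR R), measurable X ->
    (distribution P idF \x nu)%E X = distribution P J X.
  apply: (@product_measure_unique _ _ _ _ R (distribution P idF) nu
    (distribution P J)) => A B mA mB.
  rewrite /distribution /pushforward /=.
  transitivity (P (A `&` D @^-1` B)); first by [].
  rewrite Wind//; last by rewrite -measurable_filtrationE.
  by rewrite WN.
have := @ge0_integral_distribution _ _ _ _ _ P J phi mphi phi0.
rewrite /comp /= => <-.
rewrite -(@eq_measure_integral _ _ _ _ _ (distribution P idF \x nu)%E); last first.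
  by move=> X mX _; exact: joint.
rewrite fubini_tonelli1//.
rewrite (@ge0_integral_distribution _ _ _ _ _ P idF)//.
  exact: measurable_fun_fubini_tonelli_F.
by move=> w; apply: integral_ge0 => y _.
Qed.

(** The basic orthogonality relation.  The inner integral over the increment is
    computed pointwise and is a sum of two nonnegative terms, so that Tonelli's
    theorem suffices, whatever the integrability of [xi] and [c]. *)
Lemma increment_pythagoras a b (xi c : Omega -> R) : 0 <= a -> a <= b ->
  adapted_rv F a xi -> adapted_rv F a c ->
  (\int[P]_w (((xi w + c w * (W b w - W a w)) ^+ 2)%R)%:E =
   \int[P]_w (((xi w) ^+ 2)%R)%:E + \int[P]_w (((c w) ^+ 2 * (b - a))%R)%:E)%E.
Proof.
move=> a0; rewrite le_eqVlt => /predU1P[<- axi ac|ab axi ac].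
  rewrite [X in (_ + X)%E]integral0_eq => [|w _]; last by rewrite subrr mulr0.
  by rewrite adde0; apply: eq_integral => w _; rewrite subrr mulr0 addr0.
pose phi (z : Ft a * measurableTypeR R) : \bar R := ((xi z.1 + c z.1 * z.2) ^+ 2)%:E.
have mphi : measurable_fun setT phi.
  apply/measurable_EFinP/measurable_funX/measurable_funD.
    exact: measurableT_comp.
  by apply: measurable_funM => //; exact: measurableT_comp.
have phi0 z : (0 <= phi z)%E by rewrite lee_fin sqr_ge0.
have := increment_distribution a0 ab mphi phi0; rewrite /phi /= => ->.
have s0 : 0 < Num.sqrt (b - a) by rewrite sqrtr_gt0 subr_gt0.
under eq_integral do rewrite (integral_normal_affine_sqr s0) sqr_sqrtr ?subr_ge0 ?(ltW ab)// EFinD.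
rewrite ge0_integralD//.
- by move=> w _; rewrite lee_fin sqr_ge0.
- by apply/measurable_EFinP/measurable_funX; exact: adapted_measurable axi.
- by move=> w _; rewrite lee_fin mulr_ge0 ?sqr_ge0 ?subr_ge0 ?(ltW ab).
- apply/measurable_EFinP/measurable_funM => //.
  by apply/measurable_funX; exact: adapted_measurable ac.
Qed.

End filtration.

(** * Stochastic integrals of simple processes *)

Section simple_integrals.
Context {d : measure_display} {Omega : measurableType d} {R : realType}.
Variable P : probability Omega R.
Hypothesis Pcomplete : measure_is_complete P.
Variable W : R -> {RV P >-> R}.
Hypothesis WBM : standard_brownian_motion W.
Notation F := (augmented_filtration W).
Notation leb := (@lebesgue_measure R).

Section clip.
Variables a b : R.
Hypothesis ab : a <= b.

(** Moving the nodes of a simple process into [[a, b]] expresses the increment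
    of its integral between [a] and [b] as a sum of Brownian increments
    ([stopped_increment]). *)
Definition clip (x : R) := Num.max a (Num.min x b).

Lemma clip_ge x : a <= clip x. Proof. by rewrite /clip le_max lexx. Qed.

Lemma clip_homo : {homo clip : x y / x <= y}.
Proof. by move=> x y xy; rewrite /clip ge_max !le_max lexx/= le_min !ge_min xy lexx !orbT. Qed.

Lemma clip_ge_id x : x <= b -> x <= clip x.
Proof. by move=> xb; rewrite /clip le_max le_min lexx xb orbT. Qed.

Lemma clip_out x : b <= x -> clip x = b.
Proof. by move=> bx; rewrite /clip min_r// max_r. Qed.

Lemma stopped_increment (w : Omega) x y :
  (W (Num.min y b) w - W (Num.min x b) w) -
  (W (Num.min y a) w - W (Num.min x a) w) = W (clip y) w - W (clip x) w.
Proof.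
suff E z : W (Num.min z b) w - W (Num.min z a) w = W (clip z) w - W a w.
  rewrite [LHS](_ : _ = (W (Num.min y b) w - W (Num.min y a) w)
    - (W (Num.min x b) w - W (Num.min x a) w)); last by ring.
  by rewrite !E; ring.
rewrite /clip; have [za|az] := leP z a.
  by rewrite (min_l (le_trans za ab)) (max_l za) !subrr.
by rewrite max_r// le_min ab ltW.
Qed.

Lemma lebesgue_clip x y : x <= y ->
  (\int[leb]_(s in `[a, b]) (\1_(`]x, y]) s)%:E = (clip y - clip x)%:E)%E.
Proof.
move=> xy; rewrite -integral_itv_obnd_cbnd; last first.
  by apply/measurable_EFinP/measurable_funTS.
rewrite integral_indic//.
rewrite (_ : _ `&` _ = `]clip x, clip y]%classic).
  have := lebesgue_measure_itv `]clip x, clip y]; rewrite /= lte_fin => ->; case: ltP => // yx.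
  congr EFin.
  apply/eqP; rewrite eq_sym subr_eq0 eq_le yx/=; exact: clip_homo.
apply/seteqP; split => s /=; rewrite !in_itv/= /clip.
  move=> [/andP[xs sy] /andP[as_ sb]].
  by rewrite gt_max as_ gt_min xs/= le_max le_min sy sb orbT.
rewrite gt_max gt_min le_max le_min => /andP[/andP[as_ +] /orP[|/andP[sy sb]]].
  by rewrite leNgt as_.
by rewrite [b < s]ltNge sb orbF => ->; rewrite sy as_.
Qed.

End clip.

Lemma simple_value_sqr t T (h : @simple_process d Omega R) s w : is_simple F t T h ->
  simple_value h s w ^+ 2 = \sum_(i < sp_size h)
    sp_coef h i w ^+ 2 * \1_(`]sp_time h i, sp_time h i.+1]) s.
Proof.
case=> _ _ incr _ _; rewrite /simple_value.
pose I i : R := \1_(`]sp_time h i, sp_time h i.+1]) s.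
pose S k := \sum_(i < k) sp_coef h i w * I i.
have S0 k : (k <= sp_size h)%N -> sp_time h k < s -> S k = 0.
  elim: k => [|k IH] kh ks; first by rewrite /S big_ord0.
  rewrite /S big_ord_recr/= -/(S k) IH; [|exact: ltnW|]; last first.
    exact: lt_trans (incr _ kh) ks.
  by rewrite /I indicE memNset ?mulr0 ?addr0//= in_itv/= [_ <= sp_time _ _]leNgt ks andbF.
suff H k : (k <= sp_size h)%N ->
    S k ^+ 2 = \sum_(i < k) sp_coef h i w ^+ 2 * I i by exact: H.
elim: k => [|k IH] kh; first by rewrite /S !big_ord0 expr0n.
rewrite big_ord_recr/= -IH 1?ltnW// /S big_ord_recr/= -/(S k).
have -> : I k = (s \in `]sp_time h k, sp_time h k.+1]%classic)%:R.
  by rewrite /I indicE.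
have [|_] := boolP (s \in _); last by rewrite !mulr0 !addr0.
rewrite inE/= in_itv/= => /andP[ks _].
by rewrite S0 1?ltnW//; ring.
Qed.

(** The increments are added one at a time: with the nodes clipped to [[a, b]],
    every partial sum is known at the next node, and [increment_pythagoras]
    applies. *)
Lemma simple_pythagoras t T a b (h : @simple_process d Omega R) (xi : Omega -> R) :
  is_simple F t T h -> 0 <= a -> a <= b -> adapted_rv F a xi ->
  (\int[P]_w (((xi w + (simple_integral W h b w - simple_integral W h a w)) ^+ 2)%R)%:E =
   \int[P]_w (((xi w) ^+ 2)%R)%:E +
   \int[P]_w \int[leb]_(s in `[a, b]) (((simple_value h s w) ^+ 2)%R)%:E)%E.
Proof.
move=> sh a0 ab axi; have [_ _ incr adc _] := sh.
pose tau i := clip a b (sp_time h i).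
have tau_ge0 i : 0 <= tau i by exact: le_trans (clip_ge _ _ _).
have tau_incr i : (i < sp_size h)%N -> tau i <= tau i.+1.
  by move=> ih; apply/clip_homo/ltW/incr.
(* A coefficient attached to a node beyond b is not known at the clipped node,
   but the corresponding clipped increment vanishes: replace it by 0. *)
pose c i w := if sp_time h i <= b then sp_coef h i w else 0.
have ac i : (i < sp_size h)%N -> adapted_rv F (tau i) (c i).
  move=> ih; rewrite /c; case: leP => tb; last exact: measurable_cst.
  exact: (adapted_mono (clip_ge_id _ tb) (adc _ ih)).
pose D i w := W (tau i.+1) w - W (tau i) w.
have cD i w : (i < sp_size h)%N -> sp_coef h i w * D i w = c i w * D i w.
  move=> ih; rewrite /c; case: leP => // /ltW tb.
  rewrite /D /tau !clip_out// ?subrr ?mulr0//.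
  exact/(le_trans tb)/ltW/incr.
have cl i w : (i < sp_size h)%N ->
    sp_coef h i w ^+ 2 * (tau i.+1 - tau i) = c i w ^+ 2 * (tau i.+1 - tau i).
  move=> ih; rewrite /c; case: leP => // /ltW tb.
  rewrite /tau !clip_out// ?subrr ?mulr0//.
  exact/(le_trans tb)/ltW/incr.
have mc i : (i < sp_size h)%N -> measurable_fun setT (c i).
  by move=> ih; exact: (adapted_measurable Pcomplete (ac _ ih)).
have -> : (\int[P]_w \int[leb]_(s in `[a, b]) ((simple_value h s w ^+ 2)%R)%:E =
    \sum_(i < sp_size h) \int[P]_w ((c i w ^+ 2 * (tau i.+1 - tau i))%R)%:E)%E.
  rewrite -ge0_integral_sum//; last 2 first.
  - by move=> i; apply/measurable_EFinP/measurable_funM => //; exact/measurable_funX/mc.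
  - by move=> i w _; rewrite lee_fin mulr_ge0 ?sqr_ge0 ?subr_ge0 ?tau_incr.
  apply: eq_integral => w _.
  under eq_integral do rewrite (simple_value_sqr _ _ sh) -sumEFin.
  rewrite ge0_integral_sum//; last 2 first.
  - by move=> i; apply/measurable_EFinP/measurable_funM.
  - by move=> i s _; rewrite lee_fin mulr_ge0 ?sqr_ge0.
  apply: eq_bigr => i _; rewrite -cl//.
  under eq_integral do rewrite EFinM.
  rewrite ge0_integralZl//; last first.
  - by rewrite lee_fin sqr_ge0.
  - by apply/measurable_EFinP/measurable_funTS.
  by rewrite lebesgue_clip// ltW// incr.
pose f k w := xi w + \sum_(i < k) c i w * D i w.
have -> : (\int[P]_w (((xi w + (simple_integral W h b w - simple_integral W h a w)) ^+ 2)%R)%:E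
   = \int[P]_w ((f (sp_size h) w ^+ 2)%R)%:E)%E.
  apply: eq_integral => w _; rewrite /f /simple_integral -sumrB.
  congr ((_ + _) ^+ 2)%:E; apply: eq_bigr => i _.
  by rewrite -mulrBr stopped_increment// -cD.
suff H k : (k <= sp_size h)%N -> adapted_rv F (tau k) (f k) /\
  (\int[P]_w ((f k w ^+ 2)%R)%:E = \int[P]_w ((xi w ^+ 2)%R)%:E +
   \sum_(i < k) \int[P]_w ((c i w ^+ 2 * (tau i.+1 - tau i))%R)%:E)%E.
  exact: (H _ (leqnn _)).2.
elim: k => [_|k IH kh].
  rewrite big_ord0 adde0; split.
    apply: (adapted_mono (clip_ge a b _)).
    by rewrite [f _](_ : _ = xi)//; apply/funext => w; rewrite /f big_ord0 addr0.
  by apply: eq_integral => w _; rewrite /f big_ord0 addr0.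
have [af If] := IH (ltnW kh).
have fS w : f k.+1 w = f k w + c k w * (W (tau k.+1) w - W (tau k) w).
  by rewrite /f big_ord_recr/= addrA.
split.
  rewrite [f _](funext fS); apply: measurable_funD.
    exact: adapted_mono (tau_incr _ kh) af.
  apply: measurable_funM.
    exact: adapted_mono (tau_incr _ kh) (ac _ kh).
  apply: measurable_funB; first by apply: adapted_brownian.
  by apply: adapted_brownian => //; exact: tau_incr.
under eq_integral do rewrite fS.
rewrite increment_pythagoras//.
- by rewrite If big_ord_recr/=; exact/esym/addeA.
- exact: tau_incr.
- exact: ac.
Qed.

End simple_integrals.

(** * Time-space strips and Tonelli's theorem *)

Section strip.
Context {d : measure_display} {Omega : measurableType d} {R : realType}.
Variable P : probability Omega R.
Notation leb := (@lebesgue_measure R).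
Notation Z := (measurableTypeR R * Omega)%type.

Definition strip (a b : R) : set Z := `[a, b] `*` setT.

Lemma measurable_strip a b : measurable (strip a b).
Proof. exact: measurableX. Qed.
#[local] Hint Resolve measurable_strip : core.

Lemma subset_strip a b a' b' : a' <= a -> b <= b' -> strip a b `<=` strip a' b'.
Proof.
move=> aa bb [s w] [/= + _]; rewrite in_itv/= => /andP[as_ sb].
split => //=; rewrite in_itv/= (le_trans aa as_)/=; exact: le_trans bb.
Qed.

Section tonelli.
Variables (a b : R) (f : R -> Omega -> \bar R).
Hypothesis f0 : forall s w, (0 <= f s w)%E.
Hypothesis mf : measurable_fun (strip a b) (fun z => f z.1 z.2).

Let g : Z -> \bar R := (fun z => f z.1 z.2) \_ (strip a b).

Let mg : measurable_fun setT g.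
Proof.
by apply/(measurable_restrictT _ _).1.
Qed.

Let g0 z : (0 <= g z)%E.
Proof. by rewrite /g patchE; case: ifP. Qed.

Let gE s w : g (s, w) = ((f^~ w) \_ `[a, b]) s.
Proof.
rewrite /g !patchE; congr (if _ then _ else _).
by apply/idP/idP; rewrite !inE /strip /=; [case|split].
Qed.

Lemma strip_integral_path :
  (\int[leb \x P]_(z in strip a b) f z.1 z.2 =
   \int[P]_w \int[leb]_(s in `[a, b]) f s w)%E.
Proof.
rewrite integral_mkcond (fubini_tonelli2 g)//; apply: eq_integral => w _.
by rewrite [RHS]integral_mkcond; apply: eq_integral => s _; rewrite gE.
Qed.

Lemma strip_integral_time :
  (\int[leb \x P]_(z in strip a b) f z.1 z.2 =
   \int[leb]_(s in `[a, b]) \int[P]_w f s w)%E.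
Proof.
rewrite integral_mkcond (fubini_tonelli1 g)//.
rewrite [RHS]integral_mkcond; apply: eq_integral => s _; rewrite patchE.
case: ifPn => sab; first by apply: eq_integral => w _; rewrite gE patchE sab.
by apply: integral0_eq => w _; rewrite gE patchE (negbTE sab).
Qed.

Lemma measurable_path_integral :
  measurable_fun setT (fun w => \int[leb]_(s in `[a, b]) f s w)%E.
Proof.
have := @measurable_fun_fubini_tonelli_G _ _ _ _ R leb g mg g0.
apply: eq_measurable_fun => w _; rewrite [RHS]integral_mkcond.
by apply: eq_integral => s _; rewrite gE.
Qed.

Lemma measurable_time_integral :
  measurable_fun `[a, b] (fun s => \int[P]_w f s w)%E.
Proof.
have := @measurable_fun_fubini_tonelli_F _ _ _ _ R P g mg g0.
move=> /(@measurable_funTS _ _ _ _ `[a, b]).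
apply: eq_measurable_fun => s sab.
by apply: eq_integral => w _; rewrite gE patchE sab.
Qed.

End tonelli.

(** The sections of a null set of the product are null for almost every path,
    their measures having integral 0. *)
Lemma ae_path (p : R -> Omega -> Prop) :
  {ae (leb \x P)%E, forall z, p z.1 z.2} ->
  {ae P, forall w, {ae leb, forall s, p s w}}.
Proof.
move=> [N [mN N0 pN]].
pose h w := leb (ysection N w).
have mh : measurable_fun setT h by exact: measurable_fun_ysection.
have h0 : (\int[P]_w `|h w| = 0)%E.
  under eq_integral do rewrite gee0_abs ?measure_ge0//.
  rewrite -[LHS]/((leb \x^ P)%E N) -N0.
  apply/esym; apply: (@product_measure_unique _ _ _ _ R leb P (leb \x^ P)%E) => //.
  by move=> A B mA mB; exact: product_measure2E.
have /(ae_eq_integral_abs P measurableT mh) := h0.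
apply: filterS => w /(_ I) hw.
exists (ysection N w); split => //; first exact: measurable_ysection.
by move=> s /= ps; rewrite /ysection/= inE; exact: pN.
Qed.

Lemma measurable_path a b (f : R -> Omega -> R) w :
  measurable_fun (strip a b) (fun z => f z.1 z.2) ->
  measurable_fun `[a, b] (f^~ w).
Proof.
move=> mf; have mpair : measurable_fun setT (fun s : measurableTypeR R => (s, w)).
  exact: pair2_measurable.
apply: (measurable_comp (measurable_strip a b) _ mf (measurable_funTS mpair)).
by move=> _ [s sab <-].
Qed.

Lemma measurable_slice a b (f : R -> Omega -> R) s : a <= s <= b ->
  measurable_fun (strip a b) (fun z => f z.1 z.2) ->
  measurable_fun setT (f s).
Proof.
move=> sab mf; have mpair : measurable_fun setT (fun w : Omega => ((s : measurableTypeR R), w)).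
  exact: pair1_measurable.
apply: (measurable_comp (measurable_strip a b) _ mf mpair).
by move=> _ [w _ <-]; split.
Qed.

Instance ae_product_filter : Filter (almost_everywhere (leb \x P)%E) :=
  ae_filter_ringOfSetsType (leb \x P)%E.

Lemma ae_strip a b T (p : R -> Omega -> Prop) : 0 <= a -> b <= T ->
  ae_dtdP P T p ->
  {ae (leb \x P)%E, forall z, strip a b z -> p z.1 z.2}.
Proof.
move=> a0 bT; apply: filterS => -[s w] /= h [/= + _].
rewrite in_itv/= => /andP[as_ sb]; apply: h.
by rewrite (le_trans a0 as_) (le_trans sb bT).
Qed.

End strip.
#[global] Existing Instance ae_product_filter.

(** * Pythagorean inequality for the Ito integral *)

Lemma sqrD_le (R : realDomainType) (x y : R) : (x + y) ^+ 2 <= 2 * x ^+ 2 + 2 * y ^+ 2.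
Proof.
rewrite -subr_ge0 (_ : _ - _ = (x - y) ^+ 2) ?sqr_ge0//; ring.
Qed.

Section sqr_integral.
Context d (T : measurableType d) (R : realType).
Variables (mu : {measure set T -> \bar R}) (D : set T).
Hypothesis mD : measurable D.

Lemma integral_sqrD_le (f g : T -> R) : measurable_fun D f ->
  measurable_fun D g ->
  (\int[mu]_(x in D) (((f x + g x) ^+ 2)%R)%:E <=
   2%:E * \int[mu]_(x in D) ((f x ^+ 2)%R)%:E +
   2%:E * \int[mu]_(x in D) ((g x ^+ 2)%R)%:E)%E.
Proof.
move=> mf mg.
have m2 (h : T -> R) : measurable_fun D h ->
    measurable_fun D (fun x => ((h x ^+ 2)%R)%:E).
  by move=> mh; exact/measurable_EFinP/measurable_funX.
have ge0_2 (h : T -> R) x : (0 <= 2%:E * ((h x ^+ 2)%R)%:E)%E.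
  by rewrite mule_ge0 ?lee_fin ?sqr_ge0.
rewrite -!ge0_integralZl//; try exact: m2; try by move=> x _; rewrite lee_fin sqr_ge0.
rewrite -ge0_integralD//; try by apply: emeasurable_funM => //; exact: m2.
apply: ge0_le_integral => //.
- by move=> x _; rewrite lee_fin sqr_ge0.
- exact/m2/measurable_funD.
- by apply: emeasurable_funD; apply: emeasurable_funM => //; exact: m2.
- by move=> x _; rewrite lee_fin; exact: sqrD_le.
Qed.

End sqr_integral.

Section ito.
Context {d : measure_display} {Omega : measurableType d} {R : realType}.
Variable P : probability Omega R.
Hypothesis Pcomplete : measure_is_complete P.
Variable W : R -> {RV P >-> R}.
Hypothesis WBM : standard_brownian_motion W.
Notation F := (augmented_filtration W).
Notation Ft t := (g_sigma_algebraType (F t)).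
Notation leb := (@lebesgue_measure R).

Lemma progressive_joint t T (phi : R -> Omega -> R) : t <= T ->
  progressive F t T phi ->
  measurable_fun (strip t T : set (measurableTypeR R * Omega)) (fun z => phi z.1 z.2).
Proof.
move=> tT /(_ T tT (lexx _)) mphi.
have mid : measurable_fun setT (fun z : measurableTypeR R * Omega =>
    ((z.1, z.2) : measurableTypeR R * Ft T)).
  apply: measurable_fun_pair; first exact: measurable_fst.
  exact: (measurableT_comp (@measurable_id_filtration _ _ _ _ Pcomplete W T)
    (@measurable_snd _ _ (measurableTypeR R) Omega)).
have mS : measurable (`[t, T] `*` setT : set (measurableTypeR R * Ft T)).
  exact: measurableX.
apply: (measurable_comp mS _ mphi (measurable_funTS mid)).
by move=> _ [[s w] [/= sT _] <-].
Qed.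

Lemma progressive_adapted t T s (phi : R -> Omega -> R) : t <= s <= T ->
  progressive F t T phi -> adapted_rv F s (phi s).
Proof.
move=> /andP[ts sT] /(_ s ts sT) mphi.
have mpair : measurable_fun setT (fun w : Ft s => ((s : measurableTypeR R), w)).
  exact: pair1_measurable.
have mS : measurable (`[t, s] `*` setT : set (measurableTypeR R * Ft s)).
  exact: measurableX.
apply: (measurable_comp mS _ mphi mpair).
by move=> _ [w _ <-]; split => //=; rewrite in_itv/= ts lexx.
Qed.

Lemma measurable_simple_value t T (h : @simple_process d Omega R) (D : set (measurableTypeR R * Omega)) :
  is_simple F t T h -> measurable_fun D (fun z => simple_value h z.1 z.2).
Proof.
case=> _ _ _ ad _; apply: measurable_funTS; apply: measurable_sum => i.
apply: measurable_funM.
  apply: measurableT_comp; last exact: measurable_snd.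
  exact: (adapted_measurable Pcomplete (ad _ (ltn_ord i))).
apply: (measurableT_comp _ measurable_fst).
exact: measurable_indic.
Qed.

Lemma measurable_simple_integral t T (h : @simple_process d Omega R) s :
  is_simple F t T h -> measurable_fun setT (simple_integral W h s).
Proof.
case=> _ _ _ ad _; apply: measurable_sum => i.
apply: measurable_funM; last exact: measurable_funB.
exact: (adapted_measurable Pcomplete (ad _ (ltn_ord i))).
Qed.

Let ito_bound_combine (x qH qh A Bb Ba Y y : \bar R) :
  (0 <= x -> 0 <= qh -> 0 <= A -> 0 <= Bb -> 0 <= Ba -> 0 <= Y ->
   qH <= 2%:E * qh + 2%:E * A -> y = x + qh ->
   y <= 2%:E * Y + 2%:E * (2%:E * Bb + 2%:E * Ba) ->
   x + qH <= 4%:E * Y + (8%:E * Bb + 8%:E * Ba + 2%:E * A))%E.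
Proof.
move=> x0 qh0 A0 Bb0 Ba0 Y0 qHle yE yle.
apply: le_trans (leeD2l _ qHle) _; rewrite addeA.
have -> : (4%:E * Y + (8%:E * Bb + 8%:E * Ba + 2%:E * A) =
    2%:E * (2%:E * Y + 2%:E * (2%:E * Bb + 2%:E * Ba)) + 2%:E * A)%E.
  rewrite !(ge0_muleDr, adde_ge0, mule_ge0, lee_fin)// !muleA -!EFinM.
  by rewrite -!natrM !addeA.
apply: leeD2r; apply: le_trans (lee_wpmul2l _ yle); rewrite ?lee_fin//.
rewrite yE ge0_muleDr//; apply: leeD2r.
by rewrite -[leLHS]mul1e lee_wpmul2r// lee_fin ler1n.
Qed.

(** Replacing the integral by that of an approximating simple process, applying
    the exact identity, and going back costs a factor 2 each time, plus errors
    that tend to 0; whence the constant 4. *)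
Lemma ito_pythagoras_le t T a b (xi : Omega -> R) (H I : R -> Omega -> R) :
  is_ito_integral F W t T H I ->
  measurable_fun (strip t T) (fun z => H z.1 z.2) ->
  0 <= t -> t <= a -> a <= b -> b <= T -> adapted_rv F a xi ->
  (\int[P]_w ((xi w ^+ 2)%R)%:E +
   \int[leb \x P]_(z in strip a b) ((H z.1 z.2 ^+ 2)%R)%:E <=
   4%:E * \int[P]_w (((xi w + (I b w - I a w)) ^+ 2)%R)%:E)%E.
Proof.
move=> [h [sh hH hI]] mH t0 ta ab bT axi.
have a0 : 0 <= a := le_trans t0 ta.
have aT : a <= T := le_trans ab bT.
have tb : t <= b := le_trans ta ab.
have mxi := adapted_measurable Pcomplete axi.
have [mIa cIa] := hI a (introT andP (conj ta aT)).
have [mIb cIb] := hI b (introT andP (conj tb bT)).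
set Y := (\int[P]_w (((xi w + (I b w - I a w)) ^+ 2)%R)%:E)%E.
pose A k := (\int[P]_w \int[leb]_(r in `[t, T])
            (((simple_value (h k) r w - H r w) ^+ 2)%R)%:E)%E.
pose B s k := (\int[P]_w (((simple_integral W (h k) s w - I s w) ^+ 2)%R)%:E)%E.
have Y0 : (0 <= Y)%E by apply: integral_ge0 => w _; rewrite lee_fin sqr_ge0.
have bound k : (\int[P]_w ((xi w ^+ 2)%R)%:E +
   \int[leb \x P]_(z in strip a b) ((H z.1 z.2 ^+ 2)%R)%:E <=
   4%:E * Y + (8%:E * B b k + 8%:E * B a k + 2%:E * A k))%E.
  have mh := @measurable_simple_value _ _ _ (strip a b) (sh k).
  have mhT := @measurable_simple_value _ _ _ (strip t T) (sh k).
  have mHab : measurable_fun (strip a b) (fun z => H z.1 z.2).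
    exact: (measurable_funS (measurable_strip t T) (subset_strip ta bT) mH).
  have mJ s := @measurable_simple_integral _ _ _ s (sh k).
  have Qh : (\int[leb \x P]_(z in strip a b) ((simple_value (h k) z.1 z.2 ^+ 2)%R)%:E =
      \int[P]_w \int[leb]_(s in `[a, b]) (((simple_value (h k) s w) ^+ 2)%R)%:E)%E.
    rewrite (strip_integral_path P (f := fun s w => ((simple_value (h k) s w ^+ 2)%R)%:E))//.
    - by move=> s w; rewrite lee_fin sqr_ge0.
    - exact/measurable_EFinP/measurable_funX.
  have Pyth := simple_pythagoras Pcomplete WBM (sh k) a0 ab axi.
  rewrite -Qh in Pyth.
  have QH : (\int[leb \x P]_(z in strip a b) ((H z.1 z.2 ^+ 2)%R)%:E <=
      2%:E * \int[leb \x P]_(z in strip a b) ((simple_value (h k) z.1 z.2 ^+ 2)%R)%:E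
      + 2%:E * A k)%E.
    have := @integral_sqrD_le _ _ _ (leb \x P)%E (strip a b) (measurable_strip _ _)
      _ _ mh (measurable_funB mHab mh).
    under eq_integral do rewrite addrC subrK.
    move=> /le_trans; apply; rewrite leeD2l// lee_wpmul2l// ?lee_fin//.
    rewrite /A -(strip_integral_path P (f := fun s w => (((simple_value (h k) s w - H s w) ^+ 2)%R)%:E)).
    - under eq_integral do rewrite -sqrrN opprB.
      apply: ge0_subset_integral => //.
      + exact: measurable_strip.
      + exact: measurable_strip.
      + by apply/measurable_EFinP/measurable_funX/measurable_funB.
      + by move=> z _; rewrite lee_fin sqr_ge0.
      + exact: subset_strip ta bT.
    - by move=> s w; rewrite lee_fin sqr_ge0.
    - exact/measurable_EFinP/measurable_funX/measurable_funB.
  pose G w := (simple_integral W (h k) b w - I b w) + (I a w - simple_integral W (h k) a w).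
  have mG : measurable_fun setT G.
    by apply: measurable_funD; exact: measurable_funB.
  have BG : (\int[P]_w ((G w ^+ 2)%R)%:E <= 2%:E * B b k + 2%:E * B a k)%E.
    have := integral_sqrD_le P measurableT (measurable_funB (mJ b) mIb)
      (measurable_funB mIa (mJ a)).
    by under [X in (_ <= _ + _ * X)%E -> _]eq_integral do rewrite -sqrrN opprB.
  have YG : (\int[P]_w (((xi w + (simple_integral W (h k) b w -
       simple_integral W (h k) a w)) ^+ 2)%R)%:E <=
       2%:E * Y + 2%:E * (2%:E * B b k + 2%:E * B a k))%E.
    have mYf : measurable_fun setT (fun w => xi w + (I b w - I a w)).
      by apply: measurable_funD => //; exact: measurable_funB.
    have := integral_sqrD_le P measurableT mYf mG.
    rewrite (_ : (fun w => _) = (fun w => ((xi w + (simple_integral W (h k) b w -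
       simple_integral W (h k) a w)) ^+ 2)%:E)); last first.
      by apply/funext => w; congr ((_ ^+ 2)%:E); rewrite /G; ring.
    by move=> /le_trans; apply; rewrite leeD2l// lee_wpmul2l// lee_fin.
  have B0 s : (0 <= B s k)%E by apply: integral_ge0 => w _; rewrite lee_fin sqr_ge0.
  have A0 : (0 <= A k)%E.
    by do 2 (apply: integral_ge0 => ? _); rewrite lee_fin sqr_ge0.
  have xi0 : (0 <= \int[P]_w ((xi w ^+ 2)%R)%:E)%E.
    by apply: integral_ge0 => ? _; rewrite lee_fin sqr_ge0.
  have Qh0 : (0 <= \int[leb \x P]_(z in strip a b) ((simple_value (h k) z.1 z.2 ^+ 2)%R)%:E)%E.
    by apply: integral_ge0 => ? _; rewrite lee_fin sqr_ge0.
  exact: ito_bound_combine QH Pyth YG.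
have cvg0 : (4%:E * Y + (8%:E * B b k + 8%:E * B a k + 2%:E * A k))%E @[k --> \oo] --> (4%:E * Y)%E.
  rewrite -[X in _ --> X]adde0; apply: cvgeD => //.
  - by rewrite fin_num_adde_defl.
  - exact: cvg_cst.
  - rewrite -[X in _ --> X]adde0; apply: cvgeD => //.
    + rewrite -[X in _ --> X]adde0; apply: cvgeD => //.
      * by rewrite -[X in _ --> X](mule0 8%:E); exact: cvgeZl.
      * by rewrite -[X in _ --> X](mule0 8%:E); exact: cvgeZl.
    + by rewrite -[X in _ --> X](mule0 2%:E); exact: cvgeZl.
by apply: (cvge_ge _ cvg0); exact: nearW.
Qed.

End ito.

(** * One backward step for a scalar process *)

Section square_integrable_paths.
Context {R : realType}.
Notation leb := (@lebesgue_measure R).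
Variables (a b : R) (f : R -> R).
Hypothesis mf : measurable_fun `[a, b] f.

Let integrable_cst_itv (k : R) : leb.-integrable `[a, b] (EFin \o cst k).
Proof.
apply: continuous_compact_integrable; first exact: segment_compact.
exact/continuous_subspaceT/cst_continuous.
Qed.

Lemma sqr_integrable : (\int[leb]_(s in `[a, b]) ((f s ^+ 2)%R)%:E < +oo)%E ->
  leb.-integrable `[a, b] (fun s => ((f s ^+ 2)%R)%:E).
Proof.
move=> fy; apply/integrableP; split; first exact/measurable_EFinP/measurable_funX.
by under eq_integral do rewrite gee0_abs ?lee_fin ?sqr_ge0//.
Qed.

Lemma sqr_integrable_integrable :
  (\int[leb]_(s in `[a, b]) ((f s ^+ 2)%R)%:E < +oo)%E ->
  leb.-integrable `[a, b] (EFin \o f).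
Proof.
move=> /sqr_integrable if2.
apply: (le_integrable _ _ _ (integrableD _ (integrable_cst_itv 1) if2)) => //.
  exact/measurable_EFinP.
move=> s _ /=; rewrite lee_fin [leRHS]ger0_norm ?addr_ge0 ?sqr_ge0//.
have := sqr_ge0 (`|f s| - 1); rewrite -(real_normK (num_real (f s))).
have := normr_ge0 (f s); set y := `|f s| => y0 y1; nra.
Qed.

Lemma sqr_Rintegral_le : a <= b ->
  ((((\int[leb]_(s in `[a, b]) f s) ^+ 2)%R)%:E <=
   (b - a)%:E * \int[leb]_(s in `[a, b]) ((f s ^+ 2)%R)%:E)%E.
Proof.
rewrite le_eqVlt => /predU1P[ab|ab].
  by rewrite -ab set_itv1 Rintegral_set1 subrr mul0e expr0n.
have ba : 0 < b - a by rewrite subr_gt0.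
have [->|fy] := eqVneq (\int[leb]_(s in `[a, b]) ((f s ^+ 2)%R)%:E)%E +oo%E.
  by rewrite gt0_muley ?lte_fin// leey.
have {}fy : (\int[leb]_(s in `[a, b]) ((f s ^+ 2)%R)%:E < +oo)%E by rewrite ltey.
have if2 := sqr_integrable fy; have if1 := sqr_integrable_integrable fy.
set I := (\int[leb]_(s in `[a, b]) f s).
(* the minimum over m of the integral of (f - m)^2 is attained at the mean *)
pose m := I / (b - a).
have if3 : leb.-integrable `[a, b] (EFin \o (fun s => 2 * m * f s)).
  rewrite (_ : _ \o _ = fun s => (2 * m)%:E * (f s)%:E)%E//.
  exact: integrableZl.
have : \int[leb]_(s in `[a, b]) (2 * m * f s - m ^+ 2) <=
    \int[leb]_(s in `[a, b]) (f s ^+ 2).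
  apply: le_Rintegral => //.
    rewrite (_ : _ \o _ = fun s => (2 * m * f s)%:E - (m ^+ 2)%:E)%E//.
    by apply: integrableB => //; exact: (integrable_cst_itv (m ^+ 2)).
  move=> s _; have := sqr_ge0 (f s - m); lra.
rewrite RintegralB//; last exact: (integrable_cst_itv (m ^+ 2)).
rewrite RintegralZl// Rintegral_cst//.
have -> : fine (leb `[a, b]) = b - a.
  by have := lebesgue_measure_itv `[a, b]; rewrite /= lte_fin ab => ->.
rewrite -/I /Rintegral => IJ.
rewrite -(@fineK _ (\int[leb]_(s in `[a, b]) ((f s ^+ 2)%R)%:E)%E); last first.
  exact: integrable_fin_num.
rewrite -EFinM lee_fin -ler_pdivrMl//; apply: le_trans IJ.
rewrite le_eqVlt; apply/orP; left; apply/eqP; rewrite /m; field.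
by rewrite gt_eqF.
Qed.

End square_integrable_paths.

Section backward_step.
Context {d : measure_display} {Omega : measurableType d} {R : realType}.
Variable P : probability Omega R.
Notation leb := (@lebesgue_measure R).

Lemma measurable_path_Rintegral a b (f : R -> Omega -> R) :
  measurable_fun (strip a b) (fun z => f z.1 z.2) ->
  measurable_fun setT (fun w => \int[leb]_(s in `[a, b]) f s w).
Proof.
move=> mf; apply: (measurableT_comp (fine_measurable measurableT)).
have mEf : measurable_fun (strip a b) (fun z => (f z.1 z.2)%:E).
  exact/measurable_EFinP.
have -> : (fun w => \int[leb]_(s in `[a, b]) (f s w)%:E)%E =
  ((fun w => \int[leb]_(s in `[a, b]) ((fun s => (f s w)%:E)^\+ s)) \-
   (fun w => \int[leb]_(s in `[a, b]) ((fun s => (f s w)%:E)^\- s)))%E.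
  by apply/funext => w; rewrite integralE.
have mpos : measurable_fun setT
    (fun w => \int[leb]_(s in `[a, b]) ((fun s => (f s w)%:E)^\+ s))%E.
  apply: (@measurable_path_integral _ _ _ _ _
    (fun s w => ((fun s => (f s w)%:E)^\+ s)%E)) => [s w|].
    exact: funepos_ge0.
  have := measurable_funepos mEf.
  by apply: eq_measurable_fun => z _; rewrite !funeposE.
have mneg : measurable_fun setT
    (fun w => \int[leb]_(s in `[a, b]) ((fun s => (f s w)%:E)^\- s))%E.
  apply: (@measurable_path_integral _ _ _ _ _
    (fun s w => ((fun s => (f s w)%:E)^\- s)%E)) => [s w|].
    exact: funeneg_ge0.
  have := measurable_funeneg mEf.
  by apply: eq_measurable_fun => z _; rewrite !funenegE.
exact: (emeasurable_funB mpos mneg).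
Qed.

Lemma ae_path_integral_lty a b (f : R -> Omega -> \bar R) :
  (forall s w, (0 <= f s w)%E) ->
  measurable_fun (strip a b) (fun z => f z.1 z.2) ->
  (\int[leb \x P]_(z in strip a b) f z.1 z.2 < +oo)%E ->
  {ae P, forall w, (\int[leb]_(s in `[a, b]) f s w < +oo)%E}.
Proof.
move=> f0 mf fy.
have : P.-integrable setT (fun w => \int[leb]_(s in `[a, b]) f s w)%E.
  apply/integrableP; split; first exact: measurable_path_integral.
  under eq_integral do rewrite gee0_abs ?integral_ge0//.
  by rewrite -(strip_integral_path P f0 mf).
move=> /(integrable_ae measurableT); apply: filterS => w /(_ I) wfin.
by rewrite ltey_eq wfin.
Qed.

Hypothesis Pcomplete : measure_is_complete P.
Variable W : R -> {RV P >-> R}.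
Hypothesis WBM : standard_brownian_motion W.
Notation F := (augmented_filtration W).

Variables (t T : R) (X beta Z I : R -> Omega -> R) (x0 : R).
Hypothesis t0 : 0 <= t.
Hypothesis pX : progressive F t T X.
Hypothesis mbeta : measurable_fun (strip t T) (fun z => beta z.1 z.2).
Hypothesis mZ : measurable_fun (strip t T) (fun z => Z z.1 z.2).
Hypothesis beta2 :
  (\int[leb \x P]_(z in strip t T) ((beta z.1 z.2 ^+ 2)%R)%:E < +oo)%E.
Hypothesis itoI : is_ito_integral F W t T Z I.
Hypothesis XE : forall s, t <= s <= T -> {ae P, forall w,
  X s w = x0 + \int[leb]_(r in `[t, s]) beta r w + I s w}.

(** Both sides of X(a) + (I(b) - I(a)) = X(b) - int_a^b beta are squared: the
    left one is bounded from below by [ito_pythagoras_le], the right one from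
    above by the Cauchy-Schwarz inequality in time. *)
Lemma backward_step a b : t <= a -> a <= b -> b <= T ->
  (\int[P]_w ((X a w ^+ 2)%R)%:E +
   \int[leb \x P]_(z in strip a b) ((Z z.1 z.2 ^+ 2)%R)%:E <=
   8%:E * \int[P]_w ((X b w ^+ 2)%R)%:E +
   (8 * (b - a))%:E * \int[leb \x P]_(z in strip a b) ((beta z.1 z.2 ^+ 2)%R)%:E)%E.
Proof.
move=> ta ab bT.
have tb : t <= b := le_trans ta ab.
have aT : a <= T := le_trans ab bT.
have taT : t <= a <= T by rewrite ta aT.
have tbT : t <= b <= T by rewrite tb bT.
have tT : t <= T := le_trans tb bT.
have aXa : adapted_rv F a (X a) by exact: progressive_adapted pX.
have mX := progressive_joint Pcomplete tT pX.
have mXa := measurable_slice taT mX.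
have mXb := measurable_slice tbT mX.
have [h [sh hH hI]] := itoI.
have [mIa _] := hI a taT; have [mIb _] := hI b tbT.
have subab := @subset_strip d Omega R a b t T ta bT.
have mbab : measurable_fun (strip a b) (fun z => beta z.1 z.2).
  exact: (measurable_funS (measurable_strip t T) subab mbeta).
apply: le_trans (ito_pythagoras_le Pcomplete WBM itoI mZ t0 ta ab bT aXa) _.
pose V w := \int[leb]_(s in `[a, b]) beta s w.
have mV : measurable_fun setT V by exact: measurable_path_Rintegral.
have beta_sqr0 s w : (0 <= ((beta s w ^+ 2)%R)%:E)%E by rewrite lee_fin sqr_ge0.
have mbeta2 : measurable_fun (strip t T) (fun z => ((beta z.1 z.2 ^+ 2)%R)%:E).
  exact/measurable_EFinP/measurable_funX.
have mbab2 : measurable_fun (strip a b) (fun z => ((beta z.1 z.2 ^+ 2)%R)%:E).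
  exact/measurable_EFinP/measurable_funX.
have aeE : {ae P, forall w, X a w + (I b w - I a w) = X b w + - V w}.
  apply: filterS3 (XE taT) (XE tbT) (ae_path_integral_lty beta_sqr0 mbeta2 beta2).
  move=> w Ea Eb fin.
  have ibT := sqr_integrable_integrable (measurable_path w mbeta) fin.
  have ib : leb.-integrable `[t, b] (EFin \o beta^~ w).
    apply: integrableS ibT => //; exact: subset_itvl.
  have : V w = \int[leb]_(s in `[t, b]) beta s w - \int[leb]_(s in `[t, a]) beta s w.
    rewrite Rintegral_itvB ?bnd_simp// Rintegral_itv_obnd_cbnd//.
    by apply: integrableS ib => //; apply: subset_itvr; rewrite bnd_simp.
  by move=> ->; rewrite Ea Eb; ring.
have -> : (\int[P]_w (((X a w + (I b w - I a w)) ^+ 2)%R)%:E =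
    \int[P]_w (((X b w + - V w) ^+ 2)%R)%:E)%E.
  apply: ge0_ae_eq_integral => //.
  - apply/measurable_EFinP/measurable_funX/measurable_funD => //.
    exact: measurable_funB.
  - by apply/measurable_EFinP/measurable_funX/measurable_funD => //; exact: measurableT_comp.
  - by move=> w _; rewrite lee_fin sqr_ge0.
  - by move=> w _; rewrite lee_fin sqr_ge0.
  - by apply: filterS aeE => w -> _.
have V2 : (\int[P]_w (((- V w) ^+ 2)%R)%:E <= (b - a)%:E *
    \int[leb \x P]_(z in strip a b) ((beta z.1 z.2 ^+ 2)%R)%:E)%E.
  rewrite (strip_integral_path P beta_sqr0 mbab2) -ge0_integralZl//.
  - apply: ge0_le_integral => //.
    + by move=> w _; rewrite lee_fin sqr_ge0.
    + by apply/measurable_EFinP/measurable_funX; exact: measurableT_comp.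
    + by apply: emeasurable_funM => //; exact: measurable_path_integral.
    + move=> w _; rewrite sqrrN; apply: sqr_Rintegral_le => //.
      exact: measurable_path mbab.
  - exact: measurable_path_integral.
  - by move=> w _; exact: integral_ge0.
  - by rewrite lee_fin subr_ge0.
have Xb0 : (0 <= \int[P]_w ((X b w ^+ 2)%R)%:E)%E.
  by apply: integral_ge0 => w _; rewrite lee_fin sqr_ge0.
have := integral_sqrD_le P measurableT mXb (measurableT_comp (@oppr_measurable R setT) mV).
rewrite /comp => le1.
apply: le_trans (lee_wpmul2l _ le1) _ => //.
have combine (x v q : \bar R) : (0 <= x -> 0 <= v -> v <= (b - a)%:E * q ->
    4%:E * (2%:E * x + 2%:E * v) <= 8%:E * x + (8 * (b - a))%:E * q)%E.
  move=> x0' v0 vq; rewrite ge0_muleDr ?mule_ge0 ?lee_fin// !muleA -!EFinM.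
  rewrite -!natrM leeD2l// EFinM -muleA.
  by apply: lee_wpmul2l vq; rewrite lee_fin.
apply: combine => //.
by apply: integral_ge0 => w _; rewrite lee_fin sqr_ge0.
Qed.

End backward_step.

(** * Inner products and measurability of matrix processes *)

Section inner_product.
Context {R : realType}.

Lemma inner_sqrE n (x : 'cV[R]_n) : inner x x = \sum_(i < n) x i 0 ^+ 2.
Proof. by apply: eq_bigr => i _; rewrite expr2. Qed.

Lemma inner_ge0 n (x : 'cV[R]_n) : 0 <= inner x x.
Proof. by rewrite inner_sqrE sumr_ge0// => i _; exact: sqr_ge0. Qed.

Lemma innerE n (x y : 'cV[R]_n) : inner x y = (x^T *m y) 0 0.
Proof. by rewrite mxE; apply: eq_bigr => i _; rewrite mxE. Qed.

Lemma innerBl n (x y z : 'cV[R]_n) : inner (x - y) z = inner x z - inner y z.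
Proof. by rewrite -sumrB; apply: eq_bigr => i _; rewrite !mxE mulrBl. Qed.

Lemma inner0l n (y : 'cV[R]_n) : inner 0 y = 0.
Proof. by rewrite /inner big1// => i _; rewrite mxE mul0r. Qed.

Lemma inner_scalel n (c : R) (x y : 'cV[R]_n) : inner (c *: x) y = c * inner x y.
Proof. by rewrite mulr_sumr; apply: eq_bigr => i _; rewrite !mxE mulrA. Qed.

Lemma innerD_sqr_le n (x y : 'cV[R]_n) :
  inner (x + y) (x + y) <= 2 * inner x x + 2 * inner y y.
Proof.
rewrite !inner_sqrE !mulr_sumr -big_split/=; apply: ler_sum => i _.
by rewrite mxE; exact: sqrD_le.
Qed.

Lemma inner_mean_le n (x y : 'cV[R]_n) :
  2 * `|inner x y| <= inner x x + inner y y.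
Proof.
have H (z : 'cV[R]_n) : - (inner x x + inner z z) <= 2 * inner x z.
  rewrite -subr_ge0 opprK.
  have -> : 2 * inner x z + (inner x x + inner z z) = \sum_(i < n) (x i 0 + z i 0) ^+ 2.
    rewrite !inner_sqrE /inner mulr_sumr -!big_split/=.
    by apply: eq_bigr => i _; ring.
  by rewrite sumr_ge0// => i _; exact: sqr_ge0.
have := H y; have := H (- y).
have -> : inner x (- y) = - inner x y.
  by rewrite /inner -sumrN; apply: eq_bigr => i _; rewrite mxE mulrN.
have -> : inner (- y) (- y) = inner y y.
  by apply: eq_bigr => i _; rewrite mxE mulrNN.
by case: (ler0P (inner x y)) => ?; lra.
Qed.

(** Expanding the square of each entry and applying the inequality
    2 x y <= x^2 + y^2 to the pairs of products gives a dimensional constant. *)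
Lemma inner_mulmx_le p q (M : 'M[R]_(p, q)) (x : 'cV[R]_q) (k : R) :
  (forall i j, `|M i j| <= k) ->
  inner (M *m x) (M *m x) <= (p * q)%:R * k ^+ 2 * inner x x.
Proof.
move=> Mk; rewrite [leLHS]inner_sqrE.
have row_le i : (M *m x) i 0 ^+ 2 <= q%:R * k ^+ 2 * inner x x.
  have sqM j : M i j ^+ 2 <= k ^+ 2.
    rewrite -(real_normK (num_real _)) ler_sqr ?nnegrE//.
    exact: le_trans (Mk i j).
  have -> : (M *m x) i 0 ^+ 2 =
      \sum_(j < q) \sum_(l < q) (M i j * x l 0) * (M i l * x j 0).
    rewrite mxE expr2 mulr_suml; apply: eq_bigr => j _.
    by rewrite mulr_sumr; apply: eq_bigr => l _; ring.
  apply: (@le_trans _ _ (\sum_(j < q) \sum_(l < q)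
      (k ^+ 2 / 2 * x l 0 ^+ 2 + k ^+ 2 / 2 * x j 0 ^+ 2))).
    apply: ler_sum => j _; apply: ler_sum => l _.
    have h1 : M i j ^+ 2 * x l 0 ^+ 2 <= k ^+ 2 * x l 0 ^+ 2.
      by rewrite ler_wpM2r ?sqr_ge0.
    have h2 : M i l ^+ 2 * x j 0 ^+ 2 <= k ^+ 2 * x j 0 ^+ 2.
      by rewrite ler_wpM2r ?sqr_ge0.
    have := sqr_ge0 (M i j * x l 0 - M i l * x j 0).
    rewrite sqrrB !exprMn; lra.
  rewrite le_eqVlt; apply/orP; left; apply/eqP.
  under eq_bigr do rewrite big_split/= -mulr_sumr -inner_sqrE sumr_const card_ord.
  rewrite big_split/= sumr_const card_ord sumrMnl -mulr_sumr -inner_sqrE.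
  by rewrite -[X in X + _]mulr_natl -[X in _ + X]mulr_natl; field.
apply: (le_trans (ler_sum _ (fun i _ => row_le i))).
by rewrite sumr_const card_ord -[leLHS]mulr_natl natrM !mulrA.
Qed.

Lemma loewner_scalar_le n (c : R) (M : 'M[R]_n) (x : 'cV[R]_n) :
  loewner_le c%:M M -> c * inner x x <= inner (M *m x) x.
Proof.
by move=> /(_ x); rewrite mulmxBl innerBl mul_scalar_mx inner_scalel subr_ge0.
Qed.

Lemma loewner_ge0 n (M : 'M[R]_n) (x : 'cV[R]_n) :
  loewner_le 0 M -> 0 <= inner (M *m x) x.
Proof. by move=> /(_ x); rewrite subr0. Qed.

Lemma inner_gram p q (M : 'M[R]_(p, q)) (x : 'cV[R]_q) :
  inner (M^T *m M *m x) x = inner (M *m x) (M *m x).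
Proof. by rewrite !innerE !trmx_mul trmxK !mulmxA. Qed.

End inner_product.

Section measurable_matrix.
Context d (T : measurableType d) {R : realType}.
Variable D : set T.

Definition measurable_mx p q (f : T -> 'M[R]_(p, q)) :=
  forall i j, measurable_fun D (fun x => f x i j).

Lemma measurable_mulmx p q r (f : T -> 'M[R]_(p, q)) (g : T -> 'M[R]_(q, r)) :
  measurable_mx f -> measurable_mx g -> measurable_mx (fun x => f x *m g x).
Proof.
move=> mf mg i j; under eq_fun do rewrite mxE.
by apply: measurable_sum => k; exact: measurable_funM.
Qed.

Lemma measurable_addmx p q (f g : T -> 'M[R]_(p, q)) :
  measurable_mx f -> measurable_mx g -> measurable_mx (fun x => f x + g x).
Proof.
by move=> mf mg i j; under eq_fun do rewrite mxE; exact: measurable_funD.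
Qed.

Lemma measurable_inner p (f g : T -> 'cV[R]_p) :
  measurable_mx f -> measurable_mx g ->
  measurable_fun D (fun x => inner (f x) (g x)).
Proof. by move=> mf mg; apply: measurable_sum => i; exact: measurable_funM. Qed.

Lemma integral_inner (mu : {measure set T -> \bar R}) p (f : T -> 'cV[R]_p) :
  measurable D -> measurable_mx f ->
  (\int[mu]_(x in D) (inner (f x) (f x))%:E =
   \sum_(i < p) \int[mu]_(x in D) ((f x i 0 ^+ 2)%R)%:E)%E.
Proof.
move=> mD mf; rewrite -ge0_integral_sum//.
- by apply: eq_integral => x _; rewrite inner_sqrE sumEFin.
- by move=> i; exact/measurable_EFinP/measurable_funX.
- by move=> i x _; rewrite lee_fin sqr_ge0.
Qed.

End measurable_matrix.

(** * Mean squares and energies *)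

Section energy.
Context {d : measure_display} {Omega : measurableType d} {R : realType}.
Variable P : probability Omega R.
Notation leb := (@lebesgue_measure R).

Definition strip_energy p (a b : R) (u : R -> Omega -> 'cV[R]_p) : \bar R :=
  (\int[leb \x P]_(z in strip a b) (inner (u z.1 z.2) (u z.1 z.2))%:E)%E.

Definition mean_square p (s : R) (u : R -> Omega -> 'cV[R]_p) : \bar R :=
  (\int[P]_w (inner (u s w) (u s w))%:E)%E.

Section one_process.
Variables (p : nat) (t T : R) (u : R -> Omega -> 'cV[R]_p).
Hypothesis mu : measurable_mx (strip t T) (fun z => u z.1 z.2).

Let mu2 : measurable_fun (strip t T) (fun z => (inner (u z.1 z.2) (u z.1 z.2))%:E).
Proof. exact/measurable_EFinP/measurable_inner. Qed.

Let u2_ge0 s w : (0 <= (inner (u s w) (u s w))%:E)%E.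
Proof. by rewrite lee_fin inner_ge0. Qed.

Lemma measurable_mx_substrip a b : t <= a -> b <= T ->
  measurable_mx (strip a b) (fun z => u z.1 z.2).
Proof.
move=> ta bT i j.
exact: (measurable_funS (measurable_strip t T) (subset_strip ta bT) (mu i j)).
Qed.

Lemma strip_energy_ge0 a b : (0 <= strip_energy a b u)%E.
Proof. by apply: integral_ge0 => z _. Qed.

Lemma mean_square_ge0 s : (0 <= mean_square s u)%E.
Proof. exact: integral_ge0. Qed.

Lemma energyE : energy P t T u = strip_energy t T u.
Proof. by rewrite /strip_energy (strip_integral_path P u2_ge0 mu2). Qed.

Lemma strip_energy_mono a b a' b' : t <= a' -> a' <= a -> b <= b' -> b' <= T ->
  (strip_energy a b u <= strip_energy a' b' u)%E.
Proof.
move=> ta aa bb bT; apply: ge0_subset_integral => //; try exact: measurable_strip.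
  exact: (measurable_funS (measurable_strip t T) (subset_strip ta bT) mu2).
exact: subset_strip.
Qed.

Lemma strip_energy_split a b c : t <= a -> a <= b -> b <= c -> c <= T ->
  (strip_energy a c u <= strip_energy a b u + strip_energy b c u)%E.
Proof.
move=> ta ab bc cT.
have mac := measurable_funS (measurable_strip t T) (subset_strip ta cT) mu2.
have sub : strip a b `<=` (strip a c : set (measurableTypeR R * Omega)) by exact: subset_strip.
have mD : measurable (strip a c `\` strip a b : set (measurableTypeR R * Omega)).
  by apply: measurableD; exact: measurable_strip.
rewrite /strip_energy -[in leLHS](setDUK sub).
rewrite ge0_integral_setU//; first last.
- by apply/disj_set2P; rewrite setDE setIC -setIA setICl setI0.
- by rewrite setDUK.
- exact: measurable_strip.
apply: leeD => //; apply: ge0_subset_integral => //; try exact: measurable_strip.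
  exact: (measurable_funS (measurable_strip a c) (subset_strip ab (lexx c)) mac).
move=> [s w] [[/= sac _] nab]; split => //.
rewrite /= !in_itv/= in sac *; case/andP: sac => sa ->; rewrite andbT leNgt.
apply/negP => sb; apply: nab; split => //=.
by rewrite in_itv/= sa ltW.
Qed.

Lemma strip_energy_le_sup a b (M : \bar R) : t <= a -> a <= b -> b <= T ->
  (0 <= M)%E ->
  (forall s, a <= s <= b -> (mean_square s u <= M)%E) ->
  (strip_energy a b u <= (b - a)%:E * M)%E.
Proof.
move=> ta ab bT M0 uM.
have mab := measurable_funS (measurable_strip t T) (subset_strip ta bT) mu2.
rewrite /strip_energy (strip_integral_time P u2_ge0 mab).
have -> : ((b - a)%:E * M = \int[leb]_(s in `[a, b]) M)%E.
  rewrite integral_cst// muleC; congr (_ * _)%E.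
  have := lebesgue_measure_itv `[a, b]; rewrite /= lte_fin => ->.
  case: ltP => // ba; congr EFin; apply/eqP.
  by rewrite subr_eq0 eq_le ab ba.
apply: ge0_le_integral => //.
- by move=> s _; exact: integral_ge0.
- exact: measurable_time_integral.
Qed.

Lemma strip_energyE a b : t <= a -> b <= T -> (strip_energy a b u =
  \sum_(i < p) \int[leb \x P]_(z in strip a b) ((u z.1 z.2 i 0 ^+ 2)%R)%:E)%E.
Proof.
move=> ta bT; apply: integral_inner; first exact: measurable_strip.
exact: measurable_mx_substrip.
Qed.

Lemma mean_squareE s : t <= s <= T -> (mean_square s u =
  \sum_(i < p) \int[P]_w ((u s w i 0 ^+ 2)%R)%:E)%E.
Proof.
move=> tsT; apply: integral_inner => // i j.
exact: (measurable_slice (f := fun s w => u s w i j) tsT (mu i j)).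
Qed.

End one_process.

Lemma strip_energy_comb_le p q r (a b c k : R) (u : R -> Omega -> 'cV[R]_p)
    (v : R -> Omega -> 'cV[R]_q) (x : R -> Omega -> 'cV[R]_r) : 0 <= c -> 0 <= k ->
  measurable_mx (strip a b) (fun z => u z.1 z.2) ->
  measurable_mx (strip a b) (fun z => v z.1 z.2) ->
  measurable_mx (strip a b) (fun z => x z.1 z.2) ->
  {ae (leb \x P)%E, forall z, strip a b z ->
    inner (u z.1 z.2) (u z.1 z.2) <= c * inner (v z.1 z.2) (v z.1 z.2)
      + k * inner (x z.1 z.2) (x z.1 z.2)} ->
  (strip_energy a b u <= c%:E * strip_energy a b v + k%:E * strip_energy a b x)%E.
Proof.
move=> c0 k0 mu mv mx uvx; rewrite /strip_energy.
have m2 n (f : R -> Omega -> 'cV[R]_n) :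
    measurable_mx (strip a b) (fun z => f z.1 z.2) ->
    measurable_fun (strip a b) (fun z => (inner (f z.1 z.2) (f z.1 z.2))%:E).
  by move=> mf; exact/measurable_EFinP/measurable_inner.
rewrite -!ge0_integralZl//; try exact: measurable_strip; try exact: m2;
  try by move=> z _; rewrite lee_fin inner_ge0.
rewrite -ge0_integralD//; try exact: measurable_strip;
  try (by move=> z _; rewrite mule_ge0 ?lee_fin ?inner_ge0);
  try by apply: emeasurable_funM => //; exact: m2.
apply: ae_ge0_le_integral => //; first exact: measurable_strip.
- by move=> z _; rewrite lee_fin inner_ge0.
- exact: m2.
- by move=> z _; rewrite adde_ge0 ?mule_ge0 ?lee_fin ?inner_ge0.
- by apply: emeasurable_funD; apply: emeasurable_funM => //; exact: m2.
Qed.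

End energy.

(** * Absorption on short intervals and iteration *)

(** The functions [e], [x], [z] and [q] stand for s |-> E|X(s)|^2 and for the
    energies over [[a, b]] of X, of the diffusion Z and of the drift beta. *)
Section small_steps.
Context {R : realType}.
Local Open Scope ereal_scope.
Variables (t T c eps : R) (e : R -> \bar R) (x z q : R -> R -> \bar R).
Hypothesis c0 : (0 <= c)%R.
Hypothesis eps_gt0 : (0 < eps)%R.
Hypothesis eps_le1 : (eps <= 1)%R.
Hypothesis eps_c : (32 * eps * c <= 1)%R.
Hypothesis e0 : forall s, 0 <= e s.
Hypothesis x0 : forall a b, 0 <= x a b.
Hypothesis z0 : forall a b, 0 <= z a b.
Hypothesis xfin : forall a b, (t <= a)%R -> (b <= T)%R -> x a b < +oo.
Hypothesis zfin : forall a b, (t <= a)%R -> (b <= T)%R -> z a b < +oo.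
Hypothesis q_le : forall a b, (t <= a)%R -> (a <= b)%R -> (b <= T)%R ->
  q a b <= c%:E * (x a b + z a b).
Hypothesis q_mono : forall a s b, (t <= a)%R -> (a <= s)%R -> (s <= b)%R -> (b <= T)%R ->
  q s b <= q a b.
Hypothesis step : forall a b, (t <= a)%R -> (a <= b)%R -> (b <= T)%R ->
  e a + z a b <= 8%:E * e b + (8 * (b - a))%:E * q a b.
Hypothesis x_sup : forall a b M, (t <= a)%R -> (a <= b)%R -> (b <= T)%R -> 0 <= M ->
  (forall s, (a <= s <= b)%R -> e s <= M) -> x a b <= (b - a)%:E * M.
Hypothesis x_split : forall a b s, (t <= a)%R -> (a <= s)%R -> (s <= b)%R -> (b <= T)%R ->
  x a b <= x a s + x s b.
Hypothesis z_split : forall a b s, (t <= a)%R -> (a <= s)%R -> (s <= b)%R -> (b <= T)%R ->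
  z a b <= z a s + z s b.

(** Let y = x a b + z a b.  The hypothesis [step], applied to every starting
    point in [[a, b]], gives y <= 16 e(b) + 16 (b - a) c y, and the
    last term is at most y / 2 by the choice of [eps]; it can be moved to the
    left because y is finite. *)
Lemma small_step a b : (t <= a)%R -> (a <= b)%R -> (b <= T)%R ->
  (b - a <= eps)%R -> x a b + z a b <= 32%:E * e b /\ e a <= 16%:E * e b.
Proof.
move=> ta ab bT ba_eps.
have [eby|eby] := eqVneq (e b) +oo.
  by rewrite eby !gt0_muley ?lte_fin ?ltr0n// !leey.
have ebfin : e b \is a fin_num by rewrite ge0_fin_numE// ltey.
have yfin : x a b + z a b \is a fin_num.
  by rewrite ge0_fin_numE ?adde_ge0// lte_add_pinfty ?xfin ?zfin.
have y0 : (0 <= fine (x a b + z a b))%R by rewrite fine_ge0// adde_ge0.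
set y := fine (x a b + z a b) in y0.
have yE : x a b + z a b = y%:E by rewrite /y fineK.
set f := fine (e b).
have fE : e b = f%:E by rewrite /f fineK.
have f0 : (0 <= f)%R by rewrite /f fine_ge0.
have ba0 : (0 <= b - a)%R by rewrite subr_ge0.
pose M := (8 * f + 8 * (b - a) * c * y)%R.
have M0 : (0 <= M)%R by rewrite /M addr_ge0 ?mulr_ge0.
have ME : M%:E = 8%:E * f%:E + (8 * (b - a) * c * y)%:E.
  by rewrite -EFinM -EFinD.
have bound s : (a <= s <= b)%R -> e s + z s b <= M%:E.
  case/andP=> as_ sb; apply: le_trans (step (le_trans ta as_) sb bT) _.
  rewrite fE ME; apply: leeD2l.
  apply: (@le_trans _ _ ((8 * (b - s))%:E * (c%:E * y%:E))).
    apply: lee_wpmul2l; first by rewrite lee_fin mulr_ge0// subr_ge0.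
    apply: le_trans (q_mono ta as_ sb bT) _.
    by rewrite -yE; exact: q_le.
  rewrite -!EFinM lee_fin !mulrA ler_wpM2r// ler_wpM2r// ler_wpM2l// lerB//.
have zM : z a b <= M%:E.
  apply: le_trans (bound a _); last by rewrite lexx.
  by rewrite leeDr.
have eM s : (a <= s <= b)%R -> e s <= M%:E.
  by move=> /bound; apply: le_trans; rewrite leeDl.
have xM : x a b <= M%:E.
  apply: le_trans (x_sup ta ab bT _ eM) _; first by rewrite lee_fin.
  by rewrite -EFinM lee_fin ler_piMl// (le_trans ba_eps).
have yM : (y <= 2 * M)%R.
  rewrite -lee_fin -yE; apply: le_trans (leeD xM zM) _.
  by rewrite -EFinD lee_fin; lra.
have cy : (32 * ((b - a) * c * y) <= y)%R.
  apply: (@le_trans _ _ ((32 * eps * c) * y)%R); last by rewrite ler_piMl.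
  by rewrite !mulrA ler_wpM2r// ler_wpM2r// ler_wpM2l.
split.
  by rewrite yE fE -EFinM lee_fin; rewrite /M in yM; nra.
apply: le_trans (eM a _) _; first by rewrite lexx.
by rewrite fE -EFinM lee_fin; rewrite /M in yM *; nra.
Qed.

Lemma iterated_steps N a : (t <= a)%R -> (a <= T)%R -> (T - a <= N%:R * eps)%R ->
  x a T + z a T <= (32 * N.+1%:R * 16 ^+ N)%:E * e T /\ e a <= (16 ^+ N)%:E * e T.
Proof.
elim: N a => [|N IH] a ta aT Ta.
  have : (T - a <= eps)%R by move: Ta; rewrite mul0r => /le_trans; apply; exact: ltW.
  move=> /(small_step ta aT (lexx T)) [y32 _]; rewrite mulr1 expr0 mulr1; split => //.
  suff -> : a = T by rewrite mul1e.
  by apply/eqP; rewrite eq_le aT -subr_le0 -(mul0r eps).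
pose b := Num.min (a + eps)%R T.
have ab : (a <= b)%R by rewrite /b le_min aT lerDl ltW.
have bT : (b <= T)%R by rewrite /b ge_min lexx orbT.
have ba : (b - a <= eps)%R by rewrite lerBlDl /b ge_min lexx.
have tb : (t <= b)%R := le_trans ta ab.
have Tb : (T - b <= N%:R * eps)%R.
  rewrite /b; have [_|_] := leP (a + eps)%R T; last first.
    by rewrite subrr mulr_ge0 ?ler0n ?ltW.
  by move: Ta; rewrite -natr1 mulrDl mul1r; lra.
have [yb eb] := IH b tb bT Tb.
have [ya ea] := small_step ta ab bT ba.
have N0 : (1 <= 16 ^+ N :> R)%R by rewrite exprn_ege1// ler1n.
split.
  apply: (@le_trans _ _ ((x a b + z a b) + (x b T + z b T))).
    by rewrite addeACA leeD ?x_split ?z_split.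
  apply: le_trans (leeD (le_trans ya (lee_wpmul2l _ eb)) yb) _ => //.
  rewrite muleA -EFinM -ge0_muleDl ?lee_fin ?mulr_ge0 ?ler0n ?exprn_ge0//.
  rewrite -EFinD lee_wpmul2r// lee_fin exprS -[N.+2%:R]natr1.
  have : (0 <= N.+1%:R :> R)%R by [].
  set k := N.+1%:R; set p := (16 ^+ N)%R in N0 *; nra.
apply: (le_trans ea); apply: le_trans (lee_wpmul2l _ eb) _ => //.
by rewrite muleA -EFinM exprS.
Qed.

End small_steps.

(** * The terminal value dominates the control *)

(** Here z = C x + D u determines u up to x, since D u = z - C x and
    D^T D >= delta; the drift A x + B u is then bounded by x and z. *)
Lemma coercive_pointwise (R : realType) n m (A C : 'M[R]_n) (B D : 'M[R]_(n, m))
    (x : 'cV[R]_n) (u : 'cV[R]_m) (k delta : R) : 0 < delta ->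
  (forall i j, `|A i j| <= k) -> (forall i j, `|B i j| <= k) ->
  (forall i j, `|C i j| <= k) -> loewner_le delta%:M (D^T *m D) ->
  let kn := (n * n)%:R * k ^+ 2 in let km := (n * m)%:R * k ^+ 2 in
  let cu := 2 / delta * (1 + kn) in
  let y := inner x x + inner (C *m x + D *m u) (C *m x + D *m u) in
  inner u u <= cu * y /\
  inner (A *m x + B *m u) (A *m x + B *m u) <= (2 * kn + 2 * km * cu) * y.
Proof.
move=> d0 Ak Bk Ck coer kn km cu y.
have kn0 : 0 <= kn by rewrite /kn mulr_ge0 ?ler0n ?sqr_ge0.
have km0 : 0 <= km by rewrite /km mulr_ge0 ?ler0n ?sqr_ge0.
set z := C *m x + D *m u in y *.
have x0 := inner_ge0 x; have z0 := inner_ge0 z.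
have uD : delta * inner u u <= inner (D *m u) (D *m u).
  by rewrite -inner_gram; exact: loewner_scalar_le.
have Dz : inner (D *m u) (D *m u) <= 2 * inner z z + 2 * (kn * inner x x).
  have -> : D *m u = z + - (C *m x) by rewrite /z addrC addKr.
  apply: le_trans (innerD_sqr_le _ _) _; rewrite lerD2l ler_wpM2l//.
  have -> : inner (- (C *m x)) (- (C *m x)) = inner (C *m x) (C *m x).
    by apply: eq_bigr => i _; rewrite mxE mulrNN.
  exact: inner_mulmx_le.
have u_le : inner u u <= cu * y.
  rewrite -(ler_pM2l d0) (_ : delta * (cu * y) = 2 * (1 + kn) * y); last first.
    by rewrite /cu; field; rewrite gt_eqF.
  apply: le_trans uD _.
  apply: le_trans Dz _; rewrite /y; nra.
split => //; apply: le_trans (innerD_sqr_le _ _) _.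
have Ax : inner (A *m x) (A *m x) <= kn * y.
  apply: le_trans (inner_mulmx_le _ Ak) _.
  by rewrite -/kn ler_wpM2l// /y lerDl.
have Bu : inner (B *m u) (B *m u) <= km * (cu * y).
  apply: le_trans (inner_mulmx_le _ Bk) _.
  by rewrite -/km ler_wpM2l.
rewrite (_ : (2 * kn + 2 * km * cu) * y = 2 * (kn * y) + 2 * (km * (cu * y))); last first.
  by ring.
by apply: lerD; rewrite ler_wpM2l.
Qed.

Section terminal_control.
Context {d : measure_display} {Omega : measurableType d} {R : realType}.
Variable P : probability Omega R.
Hypothesis Pcomplete : measure_is_complete P.
Variable W : R -> {RV P >-> R}.
Hypothesis WBM : standard_brownian_motion W.
Notation F := (augmented_filtration W).
Notation leb := (@lebesgue_measure R).

Lemma progressive_mx_strip p q a b T (phi : R -> Omega -> 'M[R]_(p, q)) :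
  0 <= a -> b <= T -> 0 <= T -> progressive_mx F 0 T phi ->
  measurable_mx (strip a b) (fun z => phi z.1 z.2).
Proof.
move=> a0 bT T0 pphi i j.
have := progressive_joint Pcomplete T0 (pphi i j).
exact: (measurable_funS (measurable_strip 0 T) (subset_strip a0 bT)).
Qed.

Lemma L2_progressive_strip p t T (u : R -> Omega -> 'cV[R]_p) : t <= T ->
  L2_progressive P F t T u ->
  measurable_mx (strip t T) (fun z => u z.1 z.2) /\
  (strip_energy P t T u < +oo)%E.
Proof.
move=> tT [pu uy].
have mu : measurable_mx (strip t T) (fun z => u z.1 z.2).
  by move=> i j; have := progressive_joint Pcomplete tT (pu i j); exact.
by split => //; rewrite -energyE.
Qed.

(** This is the a priori estimate for linear backward equations, with Z as the
    martingale part; the constant depends on the data but not on the control. *)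
Lemma terminal_dominates_control n m (A C : R -> Omega -> 'M[R]_n)
    (B D : R -> Omega -> 'M[R]_(n, m)) (t T delta : R) :
  0 <= t -> t <= T -> 0 < delta ->
  bounded_progressive P F T A -> bounded_progressive P F T C ->
  bounded_progressive P F T B -> bounded_progressive P F T D ->
  ae_dtdP P T (fun s w => loewner_le delta%:M ((D s w)^T *m D s w)) ->
  exists2 K : R, 0 < K & forall x0 u X,
    L2_progressive P F t T u -> is_state F W A C B D t T x0 u X ->
    (strip_energy P t T u <= K%:E * mean_square P T X)%E.
Proof.
move=> t0 tT d0 [pA [kA hA]] [pC [kC hC]] [pB [kB hB]] [pD [kD hD]] coer.
have T0 : 0 <= T := le_trans t0 tT.
pose k := Num.max (Num.max kA kB) (Num.max kC kD).
pose kn := (n * n)%:R * k ^+ 2; pose km := (n * m)%:R * k ^+ 2.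
pose cu := 2 / delta * (1 + kn); pose cb := 2 * kn + 2 * km * cu.
have kn0 : 0 <= kn by rewrite /kn mulr_ge0 ?ler0n ?sqr_ge0.
have km0 : 0 <= km by rewrite /km mulr_ge0 ?ler0n ?sqr_ge0.
have cu0 : 0 < cu by rewrite /cu mulr_gt0 ?divr_gt0//; apply: ltr_pwDl.
have cb0 : 0 <= cb.
  by apply: addr_ge0; apply: mulr_ge0; rewrite ?(ltW cu0)// mulr_ge0.
(* small enough for the absorption, and at most 1 *)
pose eps := (32 * cb + 1)^-1.
have D0 : 0 < 32 * cb + 1 by apply: ltr_wpDl; rewrite ?mulr_ge0.
have eps0 : 0 < eps by rewrite invr_gt0.
have eps1 : eps <= 1 by rewrite invf_le1// lerDr mulr_ge0.
have eps_c : 32 * eps * cb <= 1.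
  rewrite mulrAC -[leLHS]/(32 * cb / (32 * cb + 1)) ler_pdivrMr// mul1r.
  by rewrite lerDl.
pose N := Num.bound ((T - t) / eps).
exists (cu * (32 * N.+1%:R * 16 ^+ N)).
  by apply: mulr_gt0.
move=> x0 u X Lu [LX _ [I [itoI XE]]].
have [mX Xy] := L2_progressive_strip tT LX.
have [mu uy] := L2_progressive_strip tT Lu.
pose Z s w := C s w *m X s w + D s w *m u s w.
pose b s w := A s w *m X s w + B s w *m u s w.
have mstrip := @progressive_mx_strip _ _ t T T _ t0 (lexx T) T0.
have mZ : measurable_mx (strip t T) (fun z => Z z.1 z.2).
  by apply: measurable_addmx; apply: measurable_mulmx => //; exact: mstrip.
have mb : measurable_mx (strip t T) (fun z => b z.1 z.2).
  by apply: measurable_addmx; apply: measurable_mulmx => //; exact: mstrip.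
have ae_bounds : ae_dtdP P T (fun s w =>
    [/\ forall i j, `|A s w i j| <= k, forall i j, `|B s w i j| <= k,
        forall i j, `|C s w i j| <= k & forall i j, `|D s w i j| <= k]).
  rewrite /ae_dtdP; near=> z => zT.
  have zA : forall i j, `|A z.1 z.2 i j| <= kA by move: zT; near: z; exact: hA.
  have zB : forall i j, `|B z.1 z.2 i j| <= kB by move: zT; near: z; exact: hB.
  have zC : forall i j, `|C z.1 z.2 i j| <= kC by move: zT; near: z; exact: hC.
  have zD : forall i j, `|D z.1 z.2 i j| <= kD by move: zT; near: z; exact: hD.
  split => i j; [apply: le_trans (zA i j) _|apply: le_trans (zB i j) _|
    apply: le_trans (zC i j) _|apply: le_trans (zD i j) _];
  by rewrite /k !le_max lexx ?orbT.
have ae_coer a c : t <= a -> c <= T -> {ae (leb \x P)%E, forall z, strip a c z ->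
    let y := inner (X z.1 z.2) (X z.1 z.2) + inner (Z z.1 z.2) (Z z.1 z.2) in
    inner (u z.1 z.2) (u z.1 z.2) <= cu * y /\
    inner (b z.1 z.2) (b z.1 z.2) <= cb * y}.
  move=> ta cT; have := ae_strip (le_trans t0 ta) cT ae_bounds.
  have := ae_strip (le_trans t0 ta) cT coer.
  apply: filterS2 => z zcoer zb zac; have [zA zB zC zD] := zb zac.
  exact: coercive_pointwise (zcoer zac).
have u_le : (strip_energy P t T u <=
    cu%:E * (strip_energy P t T X + strip_energy P t T Z))%E.
  rewrite ge0_muleDr ?strip_energy_ge0//.
  apply: strip_energy_comb_le => //; try exact: ltW.
  by apply: filterS (ae_coer t T (lexx _) (lexx _)) => z /[apply] -[+ _]; rewrite -mulrDr.
have b_le a c : t <= a -> a <= c -> c <= T -> (strip_energy P a c b <=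
    cb%:E * (strip_energy P a c X + strip_energy P a c Z))%E.
  move=> ta ac cT; rewrite ge0_muleDr ?strip_energy_ge0//.
  apply: strip_energy_comb_le => //; try exact: measurable_mx_substrip ta cT.
  by apply: filterS (ae_coer a c ta cT) => z /[apply] -[_ +]; rewrite -mulrDr.
have Z_le : (strip_energy P t T Z <= (2 * kn)%:E * strip_energy P t T X +
    (2 * km)%:E * strip_energy P t T u)%E.
  apply: strip_energy_comb_le => //; try by rewrite mulr_ge0.
  apply: filterS (ae_strip t0 (lexx T) ae_bounds) => z /[apply] -[_ _ zC zD].
  apply: le_trans (innerD_sqr_le _ _) _.
  rewrite -(mulrA 2 kn) -(mulrA 2 km) lerD// ler_wpM2l//.
    exact: inner_mulmx_le.
  exact: inner_mulmx_le.
have Zy : (strip_energy P t T Z < +oo)%E.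
  apply: le_lt_trans Z_le _; rewrite lte_add_pinfty//.
    by apply: lte_mul_pinfty => //; rewrite lee_fin (mulr_ge0 (ler0n _ 2) kn0).
  by apply: lte_mul_pinfty => //; rewrite lee_fin (mulr_ge0 (ler0n _ 2) km0).
have by_ : (strip_energy P t T b < +oo)%E.
  apply: le_lt_trans (b_le _ _ (lexx _) tT (lexx _)) _.
  by apply: lte_mul_pinfty; rewrite ?lee_fin//; exact: lte_add_pinfty.
have sub_fin p (v : R -> Omega -> 'cV[R]_p) a c : measurable_mx (strip t T) (fun z => v z.1 z.2) ->
    (strip_energy P t T v < +oo)%E -> t <= a -> c <= T -> (strip_energy P a c v < +oo)%E.
  move=> mv vy ta cT; apply: le_lt_trans vy.
  exact: (strip_energy_mono P mv (lexx t) ta cT (lexx T)).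
have step a c : t <= a -> a <= c -> c <= T ->
    (mean_square P a X + strip_energy P a c Z <=
     8%:E * mean_square P c X + (8 * (c - a))%:E * strip_energy P a c b)%E.
  move=> ta ac cT.
  have taT : t <= a <= T by rewrite ta (le_trans ac).
  have tcT : t <= c <= T by rewrite cT (le_trans ta).
  rewrite (mean_squareE P mX taT) (mean_squareE P mX tcT).
  rewrite (strip_energyE P mZ ta cT) (strip_energyE P mb ta cT).
  rewrite -big_split/= !ge0_sume_distrr; last 2 first.
  - by move=> i _; apply: integral_ge0 => z _; rewrite lee_fin sqr_ge0.
  - by move=> i _; apply: integral_ge0 => z _; rewrite lee_fin sqr_ge0.
  rewrite -big_split/=; apply: lee_sum => i _.
  apply: (@backward_step _ _ _ P Pcomplete W WBM t T (fun s w => X s w i 0)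
    (fun s w => b s w i 0) (fun s w => Z s w i 0) (I i) (x0 i 0)) => //.
  - by have [pX _] := LX; exact: pX.
  - apply: le_lt_trans by_; apply: ge0_le_integral => //; first exact: measurable_strip.
    + by move=> z _; rewrite lee_fin sqr_ge0.
    + by apply/measurable_EFinP/measurable_funX; exact: mb.
    + by apply/measurable_EFinP/measurable_inner.
    + move=> z _; rewrite lee_fin inner_sqrE (bigD1 i)//= lerDl.
      by rewrite sumr_ge0// => j _; rewrite sqr_ge0.
  - by move=> s tsT; apply: filterS (XE s tsT) => w; exact.
have NT : T - t <= N%:R * eps.
  rewrite -ler_pdivrMr//; apply/ltW; rewrite /N; apply: archi_boundP.
  by apply: divr_ge0; [rewrite subr_ge0|exact: ltW].
have [yT _] : (strip_energy P t T X + strip_energy P t T Z <=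
    (32 * N.+1%:R * 16 ^+ N)%:E * mean_square P T X /\
    mean_square P t X <= (16 ^+ N)%:E * mean_square P T X)%E.
  apply: (@iterated_steps R t T cb eps (fun s => mean_square P s X)
    (fun a c => strip_energy P a c X) (fun a c => strip_energy P a c Z)
    (fun a c => strip_energy P a c b)) => //.
  - by move=> s; exact: mean_square_ge0.
  - by move=> a c; exact: strip_energy_ge0.
  - by move=> a c; exact: strip_energy_ge0.
  - by move=> a c; exact: sub_fin.
  - by move=> a c; exact: sub_fin.
  - by move=> a s c ta as_ sc cT; exact: (strip_energy_mono P mb ta as_ (lexx c) cT).
  - by move=> a c M ta ac cT; exact: (strip_energy_le_sup mX).
  - by move=> a c s ta as_ sc cT; exact: (strip_energy_split P mX).
  - by move=> a c s ta as_ sc cT; exact: (strip_energy_split P mZ).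
have cuE : (0 <= cu%:E)%E by rewrite lee_fin ltW.
apply: le_trans u_le _; apply: le_trans (lee_wpmul2l cuE yT) _.
by rewrite muleA -EFinM.
Unshelve. all: by end_near. Qed.

End terminal_control.

(** * Lower bounds for the cost *)

Instance ae_lebesgue_filter (R : realType) :
    Filter (almost_everywhere (@lebesgue_measure R)) :=
  ae_filter_ringOfSetsType (@lebesgue_measure R).

(** The upper bound [h] makes the integral of [f] finite: otherwise the
    real-valued integral would take the default value 0 and the conclusion
    would fail. *)
Lemma ge0_le_Rintegral_ae (R : realType) (a b : R) (f g h : R -> R) :
  measurable_fun `[a, b] f -> measurable_fun `[a, b] g ->
  measurable_fun `[a, b] h ->
  (forall s, 0 <= g s) -> (forall s, 0 <= h s) ->
  {ae lebesgue_measure, forall s, `[a, b]%classic s -> g s <= f s <= h s} ->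
  (\int[lebesgue_measure]_(s in `[a, b]) (h s)%:E < +oo)%E ->
  (\int[lebesgue_measure]_(s in `[a, b]) (g s)%:E <=
   (\int[lebesgue_measure]_(s in `[a, b]) f s)%:E)%E.
Proof.
move=> mf mg mh g0 h0 gfh hy.
have mnf : measurable_fun `[a, b] (fun s => `|f s|) by exact: measurableT_comp.
have fE : (\int[lebesgue_measure]_(s in `[a, b]) (f s)%:E =
    \int[lebesgue_measure]_(s in `[a, b]) (`|f s|)%:E)%E.
  apply: ae_eq_integral => //; try exact/measurable_EFinP.
  apply: filterS gfh => s /[apply] /andP[gf _].
  by rewrite ger0_norm// (le_trans (g0 s)).
have fh : (\int[lebesgue_measure]_(s in `[a, b]) (`|f s|)%:E <=
    \int[lebesgue_measure]_(s in `[a, b]) (h s)%:E)%E.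
  apply: ae_ge0_le_integral => //; try exact/measurable_EFinP;
    try by move=> s _; rewrite lee_fin.
  apply: filterS gfh => s /[apply] /andP[gf fh].
  by rewrite lee_fin ger0_norm// (le_trans (g0 s)).
rewrite /Rintegral fineK; last first.
  rewrite fE ge0_fin_numE; last by apply: integral_ge0 => s _; rewrite lee_fin.
  exact: le_lt_trans fh hy.
rewrite fE; apply: ae_ge0_le_integral => //; try exact/measurable_EFinP;
  try by move=> s _; rewrite lee_fin.
apply: filterS gfh => s /[apply] /andP[gf _].
by rewrite lee_fin ger0_norm// (le_trans (g0 s)).
Qed.

Section cost_bound.
Context {d : measure_display} {Omega : measurableType d} {R : realType}.
Variable P : probability Omega R.
Hypothesis Pcomplete : measure_is_complete P.
Variable W : R -> {RV P >-> R}.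
Notation F := (augmented_filtration W).
Notation leb := (@lebesgue_measure R).
Variables (n m : nat) (t T : R) (G : Omega -> 'M[R]_n) (Q : R -> Omega -> 'M[R]_n)
  (S : R -> Omega -> 'M[R]_(m, n)) (N : R -> Omega -> 'M[R]_m).
Hypothesis t0 : 0 <= t.
Hypothesis tT : t <= T.
Hypothesis mG : adapted_rv_mx F T G.
Hypothesis bQ : bounded_progressive P F T Q.
Hypothesis bS : bounded_progressive P F T S.
Hypothesis bN : bounded_progressive P F T N.

Definition running_cost (X : R -> Omega -> 'cV[R]_n) (u : R -> Omega -> 'cV[R]_m) s w : R :=
  inner (Q s w *m X s w) (X s w) + 2 * inner (S s w *m X s w) (u s w)
  + inner (N s w *m u s w) (u s w).

Lemma running_cost_le : exists2 c : R, 0 <= c &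
  ae_dtdP P T (fun s w => forall X u, running_cost X u s w <=
    c * inner (X s w) (X s w) + c * inner (u s w) (u s w)).
Proof.
have [_ [kQ hQ]] := bQ; have [_ [kS hS]] := bS; have [_ [kN hN]] := bN.
pose c p q (k : R) : R := (p * q)%:R * k ^+ 2.
have c0 p q k : 0 <= c p q k by rewrite mulr_ge0 ?ler0n ?sqr_ge0.
exists (2 + c n n kQ + c m n kS + c m m kN); first by rewrite !addr_ge0.
rewrite /ae_dtdP; near=> z => zT X u.
have zQ : forall i j, `|Q z.1 z.2 i j| <= kQ by move: zT; near: z; exact: hQ.
have zS : forall i j, `|S z.1 z.2 i j| <= kS by move: zT; near: z; exact: hS.
have zN : forall i j, `|N z.1 z.2 i j| <= kN by move: zT; near: z; exact: hN.
rewrite /running_cost; set x := X _ _; set v := u _ _.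
have iQ := inner_mulmx_le x zQ; have iS := inner_mulmx_le x zS.
have iN := inner_mulmx_le v zN.
have mQ := inner_mean_le (Q z.1 z.2 *m x) x.
have mS := inner_mean_le (S z.1 z.2 *m x) v.
have mN := inner_mean_le (N z.1 z.2 *m v) v.
have nQ := ler_norm (inner (Q z.1 z.2 *m x) x).
have nS := ler_norm (inner (S z.1 z.2 *m x) v).
have nN := ler_norm (inner (N z.1 z.2 *m v) v).
rewrite -/(c n n kQ) in iQ; rewrite -/(c m n kS) in iS; rewrite -/(c m m kN) in iN.
have := c0 n n kQ; have := c0 m n kS; have := c0 m m kN.
have := inner_ge0 x; have := inner_ge0 v.
move: (c n n kQ) (c m n kS) (c m m kN) (inner x x) (inner v v) iQ iS iN mQ mS mN nQ nS nN.
move=> q s r x2 v2 iQ iS iN mQ mS mN nQ nS nN v20 x20 r0 s0 q0.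
have := mulr_ge0 q0 x20; have := mulr_ge0 s0 x20; have := mulr_ge0 r0 x20.
have := mulr_ge0 q0 v20; have := mulr_ge0 s0 v20; have := mulr_ge0 r0 v20.
lra.
Unshelve. all: by end_near. Qed.

(** Both sets of conditions are instances: the first with [gamma] = 0, the second
    with [rho] = 0. *)
Lemma cost_lower_bound (rho gamma : R) (X : R -> Omega -> 'cV[R]_n) (u : R -> Omega -> 'cV[R]_m) :
  0 <= rho -> 0 <= gamma ->
  L2_progressive P F t T X -> L2_progressive P F t T u ->
  {ae P, forall w, gamma * inner (X T w) (X T w) <= inner (G w *m X T w) (X T w)} ->
  ae_dtdP P T (fun s w => rho * inner (u s w) (u s w) <= running_cost X u s w) ->
  (gamma%:E * mean_square P T X + rho%:E * energy P t T u <=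
    cost P G Q S N t T X u)%E.
Proof.
move=> rho0 gamma0 LX Lu Gge Lge.
have T0 : 0 <= T := le_trans t0 tT.
have [mX Xy] := L2_progressive_strip Pcomplete tT LX.
have [mu uy] := L2_progressive_strip Pcomplete tT Lu.
have [c c0 Lle] := running_cost_le.
have mstrip p q phi := @progressive_mx_strip _ _ _ P Pcomplete W p q t T T phi t0 (lexx T) T0.
have mL : measurable_fun (strip t T) (fun z => running_cost X u z.1 z.2).
  have [pQ _] := bQ; have [pS _] := bS; have [pN _] := bN.
  apply: measurable_funD; [apply: measurable_funD|].
  - by apply: measurable_inner => //; apply: measurable_mulmx => //; exact: mstrip.
  - apply: measurable_funM => //.
    by apply: measurable_inner => //; apply: measurable_mulmx => //; exact: mstrip.
  - by apply: measurable_inner => //; apply: measurable_mulmx => //; exact: mstrip.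
have TT : t <= T <= T by rewrite tT lexx.
have mXT : measurable_mx setT (X T).
  by move=> i j; exact: (measurable_slice (f := fun s w => X s w i j) TT (mX i j)).
have mG' : measurable_mx setT G.
  by move=> i j; exact: (adapted_measurable Pcomplete (mG i j)).
have inn0 p (v : R -> Omega -> 'cV[R]_p) s w : (0 <= (inner (v s w) (v s w))%:E)%E.
  by rewrite lee_fin inner_ge0.
have mX2 : measurable_fun (strip t T) (fun z => inner (X z.1 z.2) (X z.1 z.2)).
  exact: measurable_inner.
have mu2 : measurable_fun (strip t T) (fun z => inner (u z.1 z.2) (u z.1 z.2)).
  exact: measurable_inner.
have mEX2 : measurable_fun (strip t T) (fun z => (inner (X z.1 z.2) (X z.1 z.2))%:E).
  exact/measurable_EFinP.
have mEu2 : measurable_fun (strip t T) (fun z => (inner (u z.1 z.2) (u z.1 z.2))%:E).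
  exact/measurable_EFinP.
pose f w := inner (G w *m X T w) (X T w) + \int[leb]_(s in `[t, T]) running_cost X u s w.
have mf : measurable_fun setT f.
  apply: measurable_funD; last exact: measurable_path_Rintegral.
  by apply: measurable_inner => //; exact: measurable_mulmx.
pose g w : \bar R := (gamma%:E * (inner (X T w) (X T w))%:E +
  rho%:E * \int[leb]_(s in `[t, T]) (inner (u s w) (u s w))%:E)%E.
have g1_0 w : (0 <= gamma%:E * (inner (X T w) (X T w))%:E)%E.
  by rewrite mule_ge0.
have g2_0 w : (0 <= rho%:E * \int[leb]_(s in `[t, T]) (inner (u s w) (u s w))%:E)%E.
  by rewrite mule_ge0// integral_ge0.
have mint : measurable_fun setT (fun w => \int[leb]_(s in `[t, T]) (inner (u s w) (u s w))%:E)%E.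
  exact: (measurable_path_integral (inn0 _ u) mEu2).
have mg1 : measurable_fun setT (fun w => (gamma%:E * (inner (X T w) (X T w))%:E)%E).
  by apply: emeasurable_funM => //; apply/measurable_EFinP/measurable_inner.
have mg2 : measurable_fun setT
    (fun w => (rho%:E * \int[leb]_(s in `[t, T]) (inner (u s w) (u s w))%:E)%E).
  by apply: emeasurable_funM.
have gf : {ae P, forall w, (g w <= (f w)%:E)%E}.
  have aeL : {ae P, forall w, {ae leb, forall s, `[t, T]%classic s ->
      rho * inner (u s w) (u s w) <= running_cost X u s w <=
      c * inner (X s w) (X s w) + c * inner (u s w) (u s w)}}.
    apply: (@ae_path _ _ _ P (fun s w => `[t, T]%classic s ->
      rho * inner (u s w) (u s w) <= running_cost X u s w <=
      c * inner (X s w) (X s w) + c * inner (u s w) (u s w))).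
    have := ae_strip t0 (lexx T) Lge; have := ae_strip t0 (lexx T) Lle.
    apply: filterS2 => -[s w] Lle' Lge' sT.
    by apply/andP; split; [exact: Lge'|exact: Lle'].
  have aeX := ae_path_integral_lty (inn0 _ X) mEX2 Xy.
  have aeu := ae_path_integral_lty (inn0 _ u) mEu2 uy.
  near=> w.
  have Gw : gamma * inner (X T w) (X T w) <= inner (G w *m X T w) (X T w).
    by near: w; exact: Gge.
  have Xw : (\int[leb]_(s in `[t, T]) (inner (X s w) (X s w))%:E < +oo)%E.
    by near: w; exact: aeX.
  have uw : (\int[leb]_(s in `[t, T]) (inner (u s w) (u s w))%:E < +oo)%E.
    by near: w; exact: aeu.
  have Lw : {ae leb, forall s, `[t, T]%classic s ->
      rho * inner (u s w) (u s w) <= running_cost X u s w <=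
      c * inner (X s w) (X s w) + c * inner (u s w) (u s w)}.
    by near: w; exact: aeL.
  have mXw := measurable_path (f := fun s w => inner (X s w) (X s w)) w mX2.
  have muw := measurable_path (f := fun s w => inner (u s w) (u s w)) w mu2.
  have mEXw : measurable_fun `[t, T] (fun s => (inner (X s w) (X s w))%:E).
    exact/measurable_EFinP.
  have mEuw : measurable_fun `[t, T] (fun s => (inner (u s w) (u s w))%:E).
    exact/measurable_EFinP.
  rewrite /g /f EFinD leeD//.
  rewrite -ge0_integralZl//.
  apply: (@ge0_le_Rintegral_ae _ t T (fun s => running_cost X u s w)
    (fun s => rho * inner (u s w) (u s w))
    (fun s => c * inner (X s w) (X s w) + c * inner (u s w) (u s w))) => //.
  - exact: measurable_path mL.
  - exact: measurable_funM.
  - by apply: measurable_funD; exact: measurable_funM.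
  - by move=> s; rewrite mulr_ge0 ?inner_ge0.
  - by move=> s; rewrite addr_ge0// mulr_ge0 ?inner_ge0.
  - under eq_integral do rewrite EFinD !EFinM.
    rewrite ge0_integralD//; first last.
    + by apply: emeasurable_funM.
    + by move=> s _; rewrite mule_ge0.
    + by apply: emeasurable_funM.
    + by move=> s _; rewrite mule_ge0.
    rewrite !ge0_integralZl//.
    by rewrite lte_add_pinfty// lte_mul_pinfty// lee_fin.
have gE : (\int[P]_w g w = gamma%:E * mean_square P T X + rho%:E * energy P t T u)%E.
  rewrite ge0_integralD// !ge0_integralZl//.
  - by move=> w _; exact: integral_ge0.
  - by apply/measurable_EFinP/measurable_inner.
have mnf : measurable_fun setT (fun w => `|f w|) by exact: measurableT_comp.
have -> : cost P G Q S N t T X u = (\int[P]_w (`|f w|)%:E)%E.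
  rewrite /cost unlock; apply: ae_eq_integral => //; try exact/measurable_EFinP.
  apply: filterS gf => w gfw _; rewrite /= -/(f w) ger0_norm//.
  by rewrite -lee_fin; apply: le_trans gfw; rewrite /g adde_ge0.
rewrite -gE; apply: ae_ge0_le_integral => //.
- by move=> w _; rewrite /g adde_ge0.
- exact: emeasurable_funD.
- exact/measurable_EFinP.
- apply: filterS gf => w gfw _; apply: le_trans gfw _.
  by rewrite lee_fin ler_norm.
Unshelve. all: by end_near. Qed.

End cost_bound.


Theorem proposition7p1 (d : measure_display) (Omega : measurableType d)
    (R : realType) (P : probability Omega R)
    (Pcomplete : measure_is_complete P)
    (W : R -> {RV P >-> R}) (WBM : standard_brownian_motion W)
    (T : R) (T_gt0 : 0 < T)
    (n m : nat) (n_gt0 : (0 < n)%N) (m_gt0 : (0 < m)%N)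
    (A C : R -> Omega -> 'M[R]_n) (B D : R -> Omega -> 'M[R]_(n, m))
    (Q : R -> Omega -> 'M[R]_n) (S : R -> Omega -> 'M[R]_(m, n))
    (N : R -> Omega -> 'M[R]_m) (G : Omega -> 'M[R]_n)
    (bA : bounded_progressive P (augmented_filtration W) T A) (bC : bounded_progressive P (augmented_filtration W) T C)
    (bB : bounded_progressive P (augmented_filtration W) T B) (bD : bounded_progressive P (augmented_filtration W) T D)
    (bQ : bounded_progressive P (augmented_filtration W) T Q) (bS : bounded_progressive P (augmented_filtration W) T S)
    (bN : bounded_progressive P (augmented_filtration W) T N)
    (symQ : forall (s : R) (w : Omega), 0 <= s <= T -> (Q s w)^T = Q s w)
    (symN : forall (s : R) (w : Omega), 0 <= s <= T -> (N s w)^T = N s w)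
    (mG : adapted_rv_mx (augmented_filtration W) T G)
    (bG : exists K : R, {ae P, forall w, forall i j, `|G w i j| <= K})
    (symG : forall w, (G w)^T = G w)
    (delta : R) (delta_gt0 : 0 < delta)
    (cond :
      [/\ {ae P, forall w, loewner_le 0 (G w)},
          ae_dtdP P T (fun s w => loewner_le 0 (Q s w)),
          ae_dtdP P T (fun s w => S s w = 0)
        & ae_dtdP P T (fun s w => loewner_le delta%:M (N s w))]
      \/
      [/\ ae_dtdP P T (fun s w => loewner_le delta%:M ((D s w)^T *m D s w)),
          {ae P, forall w, loewner_le delta%:M (G w)},
          ae_dtdP P T (fun s w => loewner_le 0 (Q s w)),
          ae_dtdP P T (fun s w => loewner_le 0 (N s w))
        & ae_dtdP P T (fun s w => S s w = 0)]) :
  forall t : R, 0 <= t < T ->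
    exists2 delta' : R, 0 < delta' &
      forall (u : R -> Omega -> 'cV[R]_m) (X : R -> Omega -> 'cV[R]_n),
        L2_progressive P (augmented_filtration W) t T u ->
        is_state (augmented_filtration W) W A C B D t T 0 u X ->
        (delta'%:E * energy P t T u <= cost P G Q S N t T X u)%E.
Proof.
move=> t /andP[t0 tT].
have tT' := ltW tT; have T0 := ltW T_gt0.
have cost_ge rho gamma X u := @cost_lower_bound _ _ _ P Pcomplete W n m t T G Q S N
  t0 tT' mG bQ bS bN rho gamma X u.
case: cond => [[G_ge Q_ge S0 N_ge]|[D_ge G_ge Q_ge N_ge S0]].
- exists delta => // u X Lu [LX _ _].
  apply: le_trans (cost_ge delta 0 X u (ltW delta_gt0) (lexx _) LX Lu _ _).
  + by rewrite mul0e add0e.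
  + by apply: filterS G_ge => w Gw; rewrite mul0r; exact: loewner_ge0.
  + apply: filterS3 Q_ge S0 N_ge => z zQ zS zN zT; rewrite /running_cost zS//.
    rewrite mul0mx inner0l mulr0 addr0.
    by apply: ler_wpDl; [exact/loewner_ge0/zQ|exact/loewner_scalar_le/zN].
- have [K K0 control] := terminal_dominates_control Pcomplete WBM t0 tT' delta_gt0
    bA bC bB bD D_ge.
  exists (delta / K); first exact: divr_gt0.
  move=> u X Lu stateX; have [LX _ _] := stateX.
  have [mu _] := L2_progressive_strip Pcomplete tT' Lu.
  have := control _ _ _ Lu stateX; rewrite -energyE// => uX.
  apply: le_trans (cost_ge 0 delta X u (lexx _) (ltW delta_gt0) LX Lu _ _).
  + rewrite mul0e adde0 EFinM -muleA lee_pmul2l//.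
    by rewrite muleC lee_pdivrMr// muleC.
  + by apply: filterS G_ge => w Gw; exact: loewner_scalar_le.
  + apply: filterS3 Q_ge S0 N_ge => z zQ zS zN zT; rewrite /running_cost zS//.
    rewrite mul0mx inner0l mulr0 addr0.
    by rewrite mul0r; apply: addr_ge0; apply: loewner_ge0; [exact: zQ|exact: zN].
Qed.
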